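(* Let $\alpha>0$ and $\sigma>0$, and put $\zeta=1/(1+\sigma)$. The radius of convergence of the series $$\sum_{m=1}^\infty\ \sum_{p=0}^{m-1}\genfrac{\{}{\}}{0pt}{}{p+m-1}{p}_{\ge 2}(-1)^{p+m-1}\,\frac{\zeta^{p+m}\tau^m}{m!},$$ regarded as a power series in $\tau$ with parameter $\sigma$, is exactly $$\tau_\ast(\sigma)=\left|1+\sigma-\sigma\ln\sigma\pm i\pi\sigma\right|$$ (the same value for both signs). Equivalently, when $\sigma=\alpha/\ln x$ and $\tau=\alpha\ln\ln x/\ln x$ with $x>1$, so that $\tau=\sigma(\ln\alpha-\ln\sigma)$, the condition of convergence of the series is $$\left|\sigma(\ln\alpha-\ln\sigma)\right|<\sqrt{(1+\sigma-\sigma\ln\sigma)^2+\pi^2\sigma^2}.$$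
   Context: $\genfrac{\{}{\}}{0pt}{}{n}{k}_{\ge 2}$ is the 2-associated Stirling subset number (second kind): the number of partitions of an $n$-element set into $k$ blocks each of size at least $2$ (with value $1$ for $n=k=0$). The outer sum is over $m$, with finite inner sums over $p$. *)

(* Defs.v *)
From Stdlib Require Import Reals.
From Coquelicot Require Import Coquelicot.
From mathcomp Require Import all_boot.

Local Open Scope R_scope.

(* [partition] already forces the blocks to be nonempty, disjoint and covering;
   stirling2_ge2 0 0 = 1 comes from the empty partition of 'I_0. *)
Definition stirling2_ge2 (n k : nat) : nat :=
  #|[set P : {set {set 'I_n}} |
      [&& partition P [set: 'I_n], #|P| == k & [forall B in P, (2 <= #|B|)%N]]]|.

(* Coefficient of tau^m. The series starts at m = 1, hence the value 0 at m = 0;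
   [sum_n f m'] is f 0 + ... + f m', so p ranges over 0, ..., m - 1. *)
Definition tau_coeff (zeta : R) (m : nat) : R :=
  if m is m'.+1 then
    sum_n (fun p : nat =>
      INR (stirling2_ge2 (p + m - 1)%N p) * (-1) ^ (p + m - 1)%N
        * (zeta ^ (p + m)%N / INR (m`!)%N)) m'
  else 0.

(* Main.v *)
Require Import Defs.
From Stdlib Require Import Reals Ranalysis5 Lra.
From Coquelicot Require Import Coquelicot.
From mathcomp Require Import all_boot all_order all_algebra Rstruct.
From mathcomp Require ring.
Set Implicit Arguments. Unset Strict Implicit. Unset Printing Implicit Defensive.
Local Open Scope nat_scope.

(** Put [f u = sigma u + 1 - e^{-u}]. Lagrange inversion identifies the series
    in tau with the Taylor series at 0 of the inverse [U] of [f] vanishing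
    there.  Critical points of [f] solve [e^{-u} = -sigma], so the critical
    values are [1 + sigma - sigma ln sigma + i pi sigma (2 k + 1)], and the
    closest ones to 0 are those of the statement.  The radius of convergence is
    the distance from 0 to them.

    The algebraic half ([tau_coeff_slope_ode]) reduces the series to a
    differential equation.  Let [V = f'(U) = 1 + sigma + sigma U - tau].  The
    three-term recurrence of the associated Stirling numbers, which follows from
    the exponential generating function [(e^u - 1 - u)^k / k!], says that [U]
    solves a linear partial differential equation in tau and zeta.  The
    first-order operator of that equation is a derivation, and it maps
    [U' V - 1] to a multiple of itself; since this series vanishes at tau = 0,
    it vanishes identically.  Hence [U' V = 1], so that [V V' = sigma - V].

    The analytic half only evaluates real power series at complex points inside
    their disc of convergence.  Integrating the equation along rays gives
    [V = sigma + e^{-U}] ([ev_slope_exp]).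

    Lower bound ([radius_ge_critical]).  When [V] is small, [U] is close to a
    critical point, so tau is close to a critical value; thus [|V|] is bounded
    below by some [d > 0] on each disc [|tau| <= R0] smaller than claimed
    ([slope_bounded_below]).  The equation [V V' = sigma - V] then bounds the
    Taylor coefficients of [V] at every point of the disc by [C B^k], where [B]
    depends on [d] only ([riccati_bound]).  If the series converges beyond the
    circle of radius [r <= R0], Cauchy's estimate on that circle, applied to the
    Hasse derivatives, gives [binom(n, k) |v_n| r^{n-k} <= C B^k]; summing over
    [k] against [h^k] with [h = 1/(2B)] bounds [|v_n| (r + h)^n].  So the radius
    exceeds [r] by a fixed amount, and finitely many steps reach [R0]
    ([radius_step]).  No analytic continuation is involved.

    Upper bound ([radius_le_critical]).  If the series converged beyond the
    critical value [c], then [U] would be defined on the segment from 0 to [c].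
    There [Im U] can equal [pi] or [-pi] only at the end point, so [Im U(c)]
    lies between 0 and [pi], and the only solution of [f u = c] in that strip is
    the critical point.  Hence [V(c) = 0], against [U' V = 1]. *)

(** * Set partitions into blocks of size at least two *)

Section SetPartitions.
Variable T : finType.
Implicit Types (A B : {set T}) (P Q : {set {set T}}).

Definition big_partitions A k : {set {set {set T}}} :=
  [set P | [&& partition P A, #|P| == k & [forall B in P, (2 <= #|B|)%N]]].

(** Removing the block [B] of a fixed element [x] leaves a partition of the
    complement of [B], and every such partition arises once. *)
Lemma big_partitionsS A k x : x \in A ->
  #|big_partitions A k.+1| =
  \sum_(B : {set T} | [&& B \subset A, x \in B & 2 <= #|B|])
    #|big_partitions (A :\: B) k|.
Proof.
move=> xA; rewrite -sum1_card.
rewrite (partition_big (fun P => pblock P x)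
  (fun B : {set T} => [&& B \subset A, x \in B & 2 <= #|B|])) /=; last first.
  move=> P; rewrite inE => /and3P[partP _ /forall_inP bigP].
  have xP : x \in cover P by rewrite (cover_partition partP).
  have BP : pblock P x \in P by rewrite pblock_mem.
  rewrite mem_pblock xP (bigP _ BP) !andbT.
  have := bigcup_sup (F := id) _ BP; rewrite -/(cover P) (cover_partition partP).
  exact.
apply: eq_bigr => B /and3P[BA xB B2].
rewrite sum1dep_card.
have BD : B :|: (A :\: B) = A.
  apply/setP => y; rewrite !inE.
  by case yB: (y \in B); rewrite ?(subsetP BA _ yB).
have disjB : [disjoint B & A :\: B] by rewrite disjoints_subset; apply/subsetP => y; rewrite !inE => ->.
have notin Q : partition Q (A :\: B) -> B \notin Q.
  move=> partQ; apply/negP => BQ.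
  have : x \in cover Q by apply/bigcupP; exists B.
  by rewrite (cover_partition partQ) inE xB.
rewrite -[RHS](card_in_imset (f := fun Q => B |: Q)); last first.
  move=> Q1 Q2; rewrite !inE => /andP[/notin n1 _] /andP[/notin n2 _] eqQ.
  by rewrite -(setU1K n1) -(setU1K n2) eqQ.
apply: eq_card => P; rewrite !inE; apply/idP/imsetP.
  case/andP=> /and3P[partP /eqP cardP /forall_inP bigP] /eqP defB.
  have BP : B \in P by rewrite -defB pblock_mem // (cover_partition partP).
  exists (P :\ B); last by rewrite setD1K.
  rewrite inE partitionD1 //=; apply/andP; split.
    by rewrite -eqSS -cardP [#|P| in X in _ == X](cardsD1 B) BP.
  by apply/forall_inP => C; rewrite inE => /andP[_ /bigP].
case=> Q; rewrite inE => /and3P[partQ /eqP cardQ /forall_inP bigQ] ->.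
have partP : partition (B |: Q) A.
  rewrite -BD; apply: partitionU1 => //.
  by apply/set0Pn; exists x.
rewrite partP cardsU1 notin // cardQ eqxx /=; apply/andP; split.
  by apply/forall_inP => C /setU1P[-> //|/bigQ].
apply/eqP; apply: def_pblock => //; last by rewrite setU11.
by case/and3P: partP.
Qed.

End SetPartitions.

(** The count by the size [j + 1] of the block of a distinguished element; it
    depends on the size of the set only. *)
Fixpoint big_partition_number (n k : nat) {struct k} : nat :=
  if k is k'.+1 then
    if n is n'.+1 then
      \sum_(j < n'.+1 | 0 < j) 'C(n', j) * big_partition_number (n' - j) k'
    else 0
  else n == 0.

Lemma card_big_partitions (T : finType) (A : {set T}) k :
  #|big_partitions A k| = big_partition_number #|A| k.
Proof.
elim: k A => [|k IHk] A.
  rewrite [RHS]/=.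
  case: (eqVneq A set0) => [->|A0].
    rewrite cards0 /= -(cards1 (set0 : {set {set T}})).
    apply: eq_card => P; rewrite !inE cards_eq0 partition_set0.
    by case: eqP => //= ->; apply/forall_inP => B; rewrite inE.
  rewrite cards_eq0 (negbTE A0) /=; apply: eq_card0 => P; rewrite !inE cards_eq0.
  apply/negP => /and3P[partP /eqP P0 _]; move: A0.
  by rewrite -(cover_partition partP) P0 /cover big_set0 eqxx.
case: (set_0Vmem A) => [->|[x xA]].
  rewrite cards0 /=; apply: eq_card0 => P; rewrite !inE partition_set0.
  by apply/negP => /and3P[/eqP ->]; rewrite cards0.
rewrite (big_partitionsS k xA) [in RHS](cardsD1 x) xA add1n /=.
set A' := A :\ x.
transitivity (\sum_(C : {set T} | (C \subset A') && (0 < #|C|))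
    big_partition_number (#|A'| - #|C|) k).
  rewrite (reindex_onto (fun C => x |: C) (fun B => B :\ x)) /=; last first.
    by move=> B /and3P[_ xB _]; rewrite setD1K.
  apply: eq_big => [C|C].
    rewrite setU11 andTb subUset sub1set xA /=.
    case xC: (x \in C).
      have -> : (C \subset A') = false.
        by apply/negP => /subsetP/(_ _ xC); rewrite !inE eqxx.
      apply/negbTE; rewrite negb_and; apply/orP; right; apply/eqP => CE.
      by move: xC; rewrite -CE !inE eqxx.
    rewrite setU1K ?xC // eqxx andbT cardsU1 xC /= add1n ltnS.
    by rewrite subsetD1 xC andbT.
  case/andP=> /and3P[CA _ _] /eqP CE; rewrite IHk; congr big_partition_number.
  have xC : x \notin C by rewrite -CE !inE eqxx.
  rewrite cardsD (setIidPr CA) (cardsD1 x) xA cardsU1 xC /=.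
  by rewrite subSS.
rewrite (partition_big (fun C : {set T} => inord #|C| : 'I_(#|A'|.+1))
  (fun j : 'I_(#|A'|.+1) => 0 < j)) /=; last first.
  by move=> C /andP[CA C0]; rewrite inordK // ltnS subset_leq_card.
apply: eq_bigr => j j0.
have -> : 'C(#|A'|, j) = \sum_(C : {set T} | (C \subset A') && (#|C| == j)) 1.
  by rewrite sum1dep_card cards_draws.
rewrite big_distrl /=; apply: eq_big => [C|C].
  case CA: (C \subset A') => //=.
  rewrite -val_eqE /= inordK ?ltnS ?subset_leq_card //.
  by case: eqP => [->|]; rewrite ?j0 ?andbF ?andbT.
case/andP=> /andP[CA _] /eqP <-; rewrite mul1n inordK //.
by rewrite ltnS subset_leq_card.
Qed.

Lemma stirling2_ge2E n k : stirling2_ge2 n k = big_partition_number n k.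
Proof. by rewrite -[in RHS](card_ord n) -cardsT -card_big_partitions. Qed.

(** * Formal power series as coefficient sequences *)

Section FormalSeries.
Import Order.TTheory GRing.Theory Num.Theory.
Import mathcomp.algebra_tactics.ring.
Local Open Scope ring_scope.
Local Arguments factorial : simpl never.

Section Ring.
Variable A : comNzRingType.
Implicit Types (f g : nat -> A) (N d : A -> A).

Definition conv f g n := \sum_(i < n.+1) f i * g (n - i)%N.
Definition fderiv f n := f n.+1 *+ n.+1.
Definition shift f n := if n is m.+1 then f m else 0.

Lemma eq_conv f f' g g' : f =1 f' -> g =1 g' -> conv f g =1 conv f' g'.
Proof. by move=> ef eg n; apply: eq_bigr => i _; rewrite ef eg. Qed.

Lemma eq_fderiv f g : f =1 g -> fderiv f =1 fderiv g.
Proof. by move=> fg n; rewrite /fderiv fg. Qed.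

Lemma convDl f f' g n :
  conv (fun i => f i + f' i) g n = conv f g n + conv f' g n.
Proof. by rewrite -big_split; apply: eq_bigr => i _; rewrite mulrDl. Qed.

Lemma convDr f g g' n :
  conv f (fun i => g i + g' i) n = conv f g n + conv f g' n.
Proof. by rewrite -big_split; apply: eq_bigr => i _; rewrite mulrDr. Qed.

Lemma convZl c f g n : conv (fun i => c * f i) g n = c * conv f g n.
Proof. by rewrite mulr_sumr; apply: eq_bigr => i _; rewrite mulrA. Qed.

Lemma convZr c f g n : conv f (fun i => c * g i) n = c * conv f g n.
Proof. by rewrite mulr_sumr; apply: eq_bigr => i _; rewrite mulrCA. Qed.

Lemma conv_shiftr f g n : conv f (shift g) n = shift (conv f g) n.
Proof.
rewrite /conv big_ord_recr /= subnn mulr0 addr0.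
case: n => [|n] /=; first by rewrite big_ord0.
by apply: eq_bigr => i _; rewrite subSn // -ltnS.
Qed.

Lemma conv_delta0l g n : conv (fun i => (i == 0%N)%:R) g n = g n.
Proof.
rewrite /conv big_ord_recl /= mul1r subn0 big1 ?addr0 // => i _.
by rewrite mul0r.
Qed.

(** Leibniz rule: the factor [n + 1] splits as [i + (n + 1 - i)]. *)
Lemma conv_fderiv f g n :
  fderiv (conv f g) n = conv (fderiv f) g n + conv f (fderiv g) n.
Proof.
have -> : fderiv (conv f g) n =
    \sum_(i < n.+2) (f i *+ i) * g (n.+1 - i)%N
    + \sum_(i < n.+2) f i * (g (n.+1 - i)%N *+ (n.+1 - i)).
  rewrite /fderiv /conv -sumrMnl -big_split; apply: eq_bigr => i _ /=.
  by rewrite mulrnAl mulrnAr -mulrnDr subnKC // -ltnS.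
congr (_ + _).
  rewrite big_ord_recl /= mulr0n mul0r add0r.
  by apply: eq_bigr => i _; rewrite /fderiv /bump /= add1n subSS.
rewrite big_ord_recr /= subnn mulr0n mulr0 addr0.
by apply: eq_bigr => i _; rewrite /fderiv subSn // -ltnS.
Qed.

Lemma fderiv_shift f n : fderiv (shift f) n = f n + shift (fderiv f) n.
Proof. by case: n => [|n]; rewrite /fderiv /= ?mulr1n ?addr0 // mulrS. Qed.

Lemma shift_fderiv f n : shift (fderiv f) n = f n *+ n.
Proof. by case: n => [|n]; rewrite ?mulr0n. Qed.

End Ring.

(** * The three-term recurrence of the associated Stirling numbers *)

Section ThreeTerm.
Variable F : numFieldType.
Local Notation S := big_partition_number.

Definition egf (k n : nat) : F := (S n k)%:R / n`!%:R.
Definition expm1 (n : nat) : F := if n is 0 then 0 else n`!%:R^-1.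

Lemma fact_neq0 n : n`!%:R != 0 :> F.
Proof. by rewrite pnatr_eq0 -lt0n fact_gt0. Qed.

Lemma div_factS (x : F) n : x / n.+1`!%:R *+ n.+1 = x / n`!%:R.
Proof.
rewrite -mulr_natr factS natrM; field.
by rewrite fact_neq0 nat1r pnatr_eq0.
Qed.

Lemma fderiv_inj (f g : nat -> F) :
  f 0%N = g 0%N -> fderiv f =1 fderiv g -> f =1 g.
Proof.
move=> fg0 fg [//|n]; have /eqP := fg n.
by rewrite /fderiv -subr_eq0 -mulrnBl mulrn_eq0 /= subr_eq0 => /eqP.
Qed.

(** The block recurrence, that is [F_{k+1}' = (e^u - 1) F_k] for the
    exponential generating functions [F_k]. *)
Lemma fderiv_egf k n : fderiv (egf k.+1) n = conv expm1 (egf k) n.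
Proof.
have n0 := fact_neq0.
rewrite /fderiv /egf div_factS /=.
rewrite natr_sum mulr_suml big_mkcond /=; apply: eq_bigr => -[j jn] _ /=.
case: j jn => [|j] jn /=; first by rewrite mul0r.
have -> : n`!%:R = 'C(n, j.+1)%:R * (j.+1`!%:R * (n - j.+1)`!%:R) :> F.
  by rewrite -!natrM bin_fact.
rewrite natrM.
have : 'C(n, j.+1)%:R != 0 :> F by rewrite pnatr_eq0 -lt0n bin_gt0.
move: (n0 j.+1) (n0 (n - j.+1)%N) => h1 h2 h3.
move: h1 h2 h3; move: (j.+1`!%:R) ((n - j.+1)`!%:R) => a b.
move: ('C(n, j.+1)%:R) ((S _ _)%:R) => c d h1 h2 h3.
by field; rewrite h1 h2 h3.
Qed.

Lemma fderiv_expm1 n : fderiv expm1 n = expm1 n + (n == 0%N)%:R.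
Proof.
rewrite /fderiv /expm1; case: n => [|n]; first by rewrite (_ : 1`! = 1)%N // invr1 add0r.
by rewrite addr0 -[_^-1]mul1r div_factS mul1r.
Qed.

(** [F_k' = k F_k + u F_{k-1}].  Knowing only [F_{k+1}' = (e^u - 1) F_k], one
    differentiates the claim for [k + 1] once: as [e^u - 1] has derivative
    [(e^u - 1) + 1], Leibniz and the claim for [k] give it. *)
Lemma egf_three_term k n :
  fderiv (egf k) n =
  egf k n *+ k + (if k is j.+1 then shift (egf j) n else 0).
Proof.
elim: k n => [|k IHk].
  by move=> n; rewrite /fderiv /egf mulr0n addr0 /= mul0r mul0rn.
apply: fderiv_inj => [|n].
  by rewrite fderiv_egf /conv big_ord1 mul0r /egf /= mul0r mul0rn addr0.
have -> : fderiv (fderiv (egf k.+1)) n = fderiv (conv expm1 (egf k)) n.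
  exact/eq_fderiv/fderiv_egf.
have -> : fderiv (fun i => egf k.+1 i *+ k.+1 + shift (egf k) i) n
        = fderiv (egf k.+1) n *+ k.+1 + (egf k n + shift (fderiv (egf k)) n).
  by rewrite -fderiv_shift /fderiv mulrnDl mulrnAC.
rewrite conv_fderiv (eq_conv fderiv_expm1 (frefl _)) convDl conv_delta0l.
rewrite -fderiv_egf mulrSr -!addrA [RHS]addrCA; congr (_ + _).
rewrite addrCA; congr (_ + _).
rewrite (eq_conv (frefl _) IHk) convDr.
rewrite (eq_conv (frefl _) (fun i => esym (mulr_natl (egf k i) k))) convZr.
rewrite -fderiv_egf mulr_natl; congr (_ + _).
case: k {IHk} => [|k].
  rewrite /conv big1 => [|i _]; last by rewrite mulr0.
  by rewrite shift_fderiv /egf; case: n => [|n]; rewrite ?mulr0n // mul0r mul0rn.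
rewrite conv_shiftr; case: n => [//|n] /=.
by rewrite fderiv_egf.
Qed.

End ThreeTerm.

(** Either the block of the last element has at least three elements, and
    removing it leaves one of [k + 1] blocks to choose from, or the block is a
    pair. *)
Lemma big_partition_numberSS n k :
  big_partition_number n.+1 k.+1 =
  (k.+1 * big_partition_number n k.+1 + n * big_partition_number n.-1 k)%N.
Proof.
have := egf_three_term rat k.+1 n; rewrite /fderiv /egf div_factS.
have n0 := fact_neq0 rat n.
move/(congr1 (fun x => x * n`!%:R)).
rewrite mulrDl [_ *+ k.+1]lock !divfK // -lock.
rewrite -[_ *+ k.+1]mulr_natl -mulrA divfK // => E.
apply/eqP; rewrite -(eqr_nat rat) natrD !natrM; apply/eqP.
rewrite E; congr (_ + _).
case: n {E} n0 => [|n] n0 /=; first by rewrite !mul0r.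
by rewrite -div_factS (mulrnAl (_ / _)) divfK // mulr_natl.
Qed.

Lemma big_partition_number_small n k :
  (n < k.*2)%N -> big_partition_number n k = 0%N.
Proof.
elim: k n => [|k IHk] [|n] //= nk.
rewrite big1 // => j j0; rewrite IHk ?muln0 //.
rewrite ltn_subLR; last by rewrite -ltnS.
rewrite doubleS !ltnS in nk; apply: leq_ltn_trans nk _.
by rewrite -[X in (X < _)%N]add0n ltn_add2r.
Qed.

Lemma sum_ord_shift (V : zmodType) (G : nat -> V) m :
  G 0%N = 0 -> G m = 0 -> \sum_(i < m) G i = \sum_(i < m) G i.+1.
Proof.
move=> G0 Gm; transitivity (\sum_(i < m.+1) G i).
  by rewrite big_ord_recr /= Gm addr0.
by rewrite big_ord_recl G0 add0r.
Qed.

(** * Lagrange inversion through a linear differential equation *)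

Section LagrangeInversion.
Variable F : numFieldType.
Local Notation S := big_partition_number.

(** The operator [sigma d/dsigma], written in [zeta = 1/(1 + sigma)]. *)
Definition zeta_derivation (q : {poly F}) := - ('X * (1 - 'X)) * q^`().
Local Notation delta := zeta_derivation.

Lemma zeta_derivationM p q : delta (p * q) = delta p * q + p * delta q.
Proof. by rewrite /delta derivM; ring. Qed.

Lemma zeta_derivationD p q : delta (p + q) = delta p + delta q.
Proof. by rewrite /delta derivD mulrDr. Qed.

Lemma zeta_derivationC c : delta c%:P = 0.
Proof. by rewrite /delta derivC mulr0. Qed.

Lemma zeta_derivation_sum (I : Type) (r : seq I) (P : pred I) (G : I -> {poly F}) :
  delta (\sum_(i <- r | P i) G i) = \sum_(i <- r | P i) delta (G i).
Proof. by rewrite /delta raddf_sum mulr_sumr. Qed.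

Lemma zeta_derivationMn p n : delta (p *+ n) = delta p *+ n.
Proof. by rewrite /delta derivMn mulrnAr. Qed.

Lemma zeta_derivationXn n : delta 'X^n = ('X^(n.+1) - 'X^n) *+ n.
Proof.
case: n => [|n]; first by rewrite /delta derivC mulr0 mulr0n.
by rewrite /delta derivXn mulrnAr; congr (_ *+ _); rewrite /= !exprS; ring.
Qed.

Definition signed_stirling (m p : nat) : F :=
  (-1) ^+ (p + m - 1) * (S (p + m - 1) p)%:R.

Definition inverse_numer m : {poly F} :=
  if m is m'.+1 then \sum_(p < m) (signed_stirling m p)%:P * 'X^(p + m) else 0.

Lemma signed_stirlingS m p : (0 < m)%N ->
  signed_stirling m.+1 p.+1 =
  signed_stirling m p *+ (p + m) - signed_stirling m p.+1 *+ p.+1.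
Proof.
case: m => [//|m] _; rewrite /signed_stirling.
rewrite !addnS !addSn !subSS !subn0 big_partition_numberSS succnK.
rewrite natrD !natrM !exprS.
move: (S _ p.+1) (S _ p) ((-1) ^+ _) => a b e; ring.
Qed.

(** The three-term recurrence for all [p] at once: in terms of sigma it reads
    [(1 + sigma) b_{m+1} = m b_m + sigma db_m/dsigma]. *)
Lemma inverse_numerS m : (0 < m)%N ->
  inverse_numer m.+1 =
  'X * (inverse_numer m *+ m + delta (inverse_numer m)).
Proof.
move=> m0; set s := signed_stirling.
have smm : s m m = 0.
  rewrite /s /signed_stirling big_partition_number_small ?mulr0 //.
  by rewrite -addnn subn1 prednK // addn_gt0 m0.
have -> : inverse_numer m = \sum_(p < m) (s m p)%:P * 'X^(p + m).
  by case: (m) m0.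
rewrite zeta_derivation_sum -sumrMnl -big_split mulr_sumr /=.
transitivity (\sum_(p < m)
   ((s m p)%:P * 'X^((p + m).+2) *+ (p + m) - (s m p)%:P * 'X^((p + m).+1) *+ p)).
  rewrite /= big_ord_recl /=.
  have s0 : s m.+1 0%N = 0.
    by rewrite /s /signed_stirling; case: (m) m0 => [//|n] _ /=; rewrite mulr0.
  rewrite -/s s0 polyC0 mul0r add0r.
  transitivity (\sum_(i < m) ((s m i)%:P * 'X^((i + m).+2) *+ (i + m)
       - (s m i.+1)%:P * 'X^((i.+1 + m).+1) *+ i.+1)).
    apply: eq_bigr => i _; rewrite /bump /= add1n /s signed_stirlingS //.
    rewrite -/s polyCB !polyCMn mulrBl !mulrnAl.
    by rewrite !addSn !addnS.
  rewrite !sumrB; congr (_ - _).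
  apply: esym.
  (* both boundary terms vanish, at p = 0 by the factor p and at p = m as the
     number of elements 2 m - 1 is too small for m blocks *)
  apply: (sum_ord_shift (G := fun i => (s m i)%:P * 'X^((i + m).+1) *+ i)).
    by rewrite mulr0n.
  by rewrite smm polyC0 mul0r mul0rn.
apply: eq_bigr => p _.
rewrite zeta_derivationM zeta_derivationC mul0r add0r.
rewrite zeta_derivationXn !exprS.
ring.
Qed.

Definition inverse_series m : {poly F} := (m`!%:R^-1)%:P * inverse_numer m.

(** The operator [(1 - zeta tau) d/dtau - zeta sigma d/dsigma] on power series
    in tau.  It is chosen so that [inverse_numerS] says that the series of the
    statement is mapped to the constant [zeta]. *)
Definition transport (f : nat -> {poly F}) n :=
  fderiv f n - 'X * (f n *+ n + delta (f n)).

(** [transport] is a derivation of the algebra of power series. *)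
Lemma transport_conv f g n :
  transport (conv f g) n = conv (transport f) g n + conv f (transport g) n.
Proof.
rewrite /transport conv_fderiv.
transitivity (conv (fderiv f) g n + conv f (fderiv g) n -
  (conv (fun i => 'X * (f i *+ i + delta (f i))) g n +
   conv f (fun i => 'X * (g i *+ i + delta (g i))) n)).
  congr (_ - _); rewrite convZl convZr -mulrDr; congr (_ * _).
  rewrite /conv -sumrMnl zeta_derivation_sum -!big_split.
  apply: eq_bigr => -[i /= lein] _; rewrite ltnS in lein.
  have -> : f i * g (n - i)%N *+ n
          = f i * g (n - i)%N *+ i + f i * g (n - i)%N *+ (n - i).
    by rewrite -mulrnDr subnKC.
  by rewrite zeta_derivationM; ring.
rewrite opprD addrACA /conv -!sumrB.
by congr (_ + _); apply: eq_bigr => i _; rewrite ?mulrBl ?mulrBr.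
Qed.

Lemma transport_inverse_series n :
  transport inverse_series n = 'X * (n == 0%N)%:R.
Proof.
rewrite /transport /fderiv /inverse_series.
have -> p : (n.+1`!%:R^-1)%:P * p *+ n.+1 = (n`!%:R^-1)%:P * p :> {poly F}.
  rewrite -mulrnAl -polyCMn; congr (_%:P * _).
  by rewrite -[_^-1]mul1r div_factS mul1r.
case: n => [|n].
  rewrite /= mulr0 -{2}polyC0 zeta_derivationC big_ord1 /signed_stirling /=.
  by rewrite fact0 invr1; ring.
rewrite [inverse_numer n.+2]inverse_numerS // mulr0.
rewrite zeta_derivationM zeta_derivationC mul0r add0r -mulrnAr.
by ring.
Qed.

(** Differentiate the equation for [U] in tau: the commutator of [transport]
    with [d/dtau] is [zeta d/dtau]. *)
Lemma transport_fderiv_inverse n :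
  transport (fderiv inverse_series) n = 'X * fderiv inverse_series n.
Proof.
have := transport_inverse_series n.+1; rewrite /transport mulr0.
move/(congr1 (fun x => x *+ n.+1)); rewrite mul0rn => /eqP.
rewrite mulrnBl subr_eq0 => /eqP E.
rewrite {1}/fderiv E.
by rewrite /fderiv zeta_derivationMn; ring.
Qed.

(** [zeta V], with [V = 1 + sigma + sigma U - tau]; the factor [zeta] keeps the
    coefficients polynomial, as [zeta sigma = 1 - zeta]. *)
Definition scaled_slope n : {poly F} :=
  (n == 0%N)%:R + (1 - 'X) * inverse_series n - 'X * (n == 1%N)%:R.

Lemma transport_scaled_slope n : transport scaled_slope n = - 'X^2 * scaled_slope n.
Proof.
have E := transport_inverse_series n; move: E; rewrite /transport => E.
have dX : delta 'X = - ('X * (1 - 'X)) by rewrite /delta derivX mulr1.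
have d1 (b : bool) : delta b%:R = 0.
  by rewrite -polyC_natr zeta_derivationC.
have dN q : delta (- q) = - delta q by rewrite /delta derivN mulrN.
have fE : fderiv inverse_series n =
   'X * (n == 0%N)%:R + 'X * (inverse_series n *+ n + delta (inverse_series n)).
  by apply/eqP; rewrite -subr_eq E.
have fS : fderiv scaled_slope n = (1 - 'X) * fderiv inverse_series n - 'X * (n == 0%N)%:R.
  rewrite /fderiv /scaled_slope /= add0r mulrnBl -!mulrnAr; congr (_ - _ * _).
  by case: n {E fE} => [|n] //=; rewrite mul0rn.
rewrite fS fE /scaled_slope.
rewrite !zeta_derivationD dN !zeta_derivationM !d1 zeta_derivationD dN dX -polyC1 zeta_derivationC.
move: (delta _) (inverse_series n) => d u.
by case: n {E fE fS} => [|[|n]] /=; ring.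
Qed.

(** [U' V = 1].  The error [E = U' (zeta V) - zeta] satisfies
    [transport E = (zeta - zeta^2) E], which determines its coefficients
    recursively from [E_0 = 0]. *)
Lemma inverse_series_ode n :
  conv (fderiv inverse_series) scaled_slope n = 'X * (n == 0%N)%:R.
Proof.
set E := fun n => conv (fderiv inverse_series) scaled_slope n - 'X * (n == 0%N)%:R.
suff E0 : E n = 0 by apply/eqP; rewrite -subr_eq0; apply/eqP.
have LE m : transport E m = ('X - 'X^2) * E m.
  have -> : transport E m = transport (conv (fderiv inverse_series) scaled_slope) m
     - transport (fun m => 'X * (m == 0%N)%:R) m.
    rewrite /transport /E /fderiv mulrnBl.
    have -> p q : delta (p - q) = delta p - delta q.
      by rewrite /delta derivB mulrBr.
    by rewrite mulrnBl; ring.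
  rewrite transport_conv (eq_conv transport_fderiv_inverse (frefl _)).
  rewrite (eq_conv (frefl _) transport_scaled_slope) convZl convZr.
  rewrite /transport /fderiv /E mulr0 mul0rn zeta_derivationM.
  have -> : delta (m == 0%N)%:R = 0.
    by rewrite -polyC_natr zeta_derivationC.
  rewrite /delta derivX.
  by case: m => [|m] /=; ring.
elim: n => [|n IHn].
  rewrite /E /conv big_ord1 /fderiv /scaled_slope /inverse_series /= fact0 big_ord1.
  by rewrite /signed_stirling /= (_ : 1`! = 1)%N // invr1 expr1; ring.
have := LE n; rewrite /transport IHn mul0rn /delta deriv0 mulr0 addr0 !mulr0 subr0.
by move/eqP; rewrite /fderiv -mulr_natl -polyC_natr mul_polyC scaler_eq0 pnatr_eq0 => /eqP.
Qed.
End LagrangeInversion.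

End FormalSeries.

(** * The coefficients of the series in tau *)

Section Bridge.
Import Order.TTheory GRing.Theory Num.Theory.
Local Open Scope ring_scope.

Lemma tau_coeff_horner (zeta : R) m :
  tau_coeff zeta m = (inverse_series _ m).[zeta].
Proof.
case: m => [|m]; first by rewrite /inverse_series /= mulr0 horner0.
rewrite /tau_coeff sum_n_Reals sum_f_R0E big_mkord /inverse_series.
rewrite hornerM hornerC /= horner_sum mulr_sumr; apply: eq_bigr => p _.
rewrite hornerM hornerC hornerXn /signed_stirling -stirling2_ge2E.
move: (stirling2_ge2 _ _) => S.
rewrite !INRE !RpowE RdivE.
rewrite (_ : IZR (-1) = -1) //.
rewrite !RmultE mulrC mulrA [_ / _]mulrC -!mulrA; congr (_ * _).
by rewrite mulrCA mulrA mulrC mulrA.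
Qed.

Local Open Scope R_scope.

Lemma tau_coeff_ode (zeta : R) n :
  PS_mult (PS_derive (tau_coeff zeta))
    (fun i => (if i is 0%N then 1 else 0) + (1 - zeta) * tau_coeff zeta i
              - zeta * (if i is 1%N then 1 else 0)) n
  = if n is 0%N then zeta else 0.
Proof.
have := congr1 (horner^~ zeta) (inverse_series_ode R n).
rewrite /= /conv horner_sum hornerM hornerX => E.
rewrite /PS_mult sum_f_R0E big_mkord.
transitivity (zeta * ((n == 0%N)%:R : {poly R}).[zeta])%R.
  rewrite -E; apply: eq_bigr => i _.
  rewrite hornerM; congr (_ * _).
    by rewrite /fderiv hornerMn -tau_coeff_horner /PS_derive INRE RmultE mulr_natl.
  rewrite minusE /scaled_slope tau_coeff_horner.
  move: (n - i)%N => j; move: (inverse_series _ j) => u.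
  rewrite hornerD hornerN hornerD !hornerM hornerD hornerN hornerX hornerC.
  by case: j => [|[|j]]; rewrite ?hornerC ?horner0.
by case: n {E} => [|n]; rewrite /= ?hornerC ?horner0 ?mulr1 ?mulr0.
Qed.

End Bridge.

Local Open Scope R_scope.

(** * Complex values of real power series *)

Definition re_coef (f : nat -> R) (c : C) (n : nat) : R := f n * Re (c ^ n)%C.
Definition im_coef (f : nat -> R) (c : C) (n : nat) : R := f n * Im (c ^ n)%C.
(** The value at [c] of the power series [f], as two real series evaluated at
    1; evaluating those at [t] instead gives the values along the ray [t c]. *)
Definition ev (f : nat -> R) (c : C) : C :=
  (PSeries (re_coef f c) 1, PSeries (im_coef f c) 1).

Lemma im_le_Cmod (c : C) : Rabs (Im c) <= Cmod c.
Proof. by apply: Rle_trans (Rmax_Cmod c); apply: Rmax_r. Qed.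

Lemma Rbar_lt_between (r : R) (z : Rbar) :
  Rbar_lt r z -> exists s : R, r < s /\ Rbar_lt s z.
Proof.
case: z => [x||] //= rx; first by exists ((r + x) / 2); split => /=; lra.
by exists (r + 1); split => //=; lra.
Qed.
(** Having radius greater than 1, and not just converging at 1, is what
    products and derivatives require. *)
Lemma CV_radius_gt1 (f g : nat -> R) (r : R) :
  0 <= r -> Rbar_lt r (CV_radius f) -> (forall n, Rabs (g n) <= Rabs (f n) * r ^ n) ->
  Rbar_lt 1 (CV_radius g).
Proof.
move=> r0 rf gf.
have [s [rs sf]] := Rbar_lt_between rf.
pose q := s / ((r + s) / 2).
have q1 : 1 < q by apply/Rlt_div_r; lra.
have rq : 0 <= r * q <= s.
  split; first by apply: Rmult_le_pos; lra.
  have -> : r * q = s - s * ((s - r) / (r + s)) by rewrite /q; field; lra.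
  have : 0 <= s * ((s - r) / (r + s)); last lra.
  by apply: Rmult_le_pos; first lra; apply: Rdiv_le_0_compat; lra.
have gq : CV_disk g q.
  apply: (@ex_series_le _ _ _ (fun n => Rabs (f n * (r * q) ^ n))); last first.
    apply: CV_disk_inside; apply: Rbar_le_lt_trans sf => /=.
    by rewrite Rabs_pos_eq; lra.
  move=> n; rewrite /norm /= /abs /= Rabs_Rabsolu !Rabs_mult Rpow_mult_distr Rabs_mult.
  rewrite -Rmult_assoc; apply: Rmult_le_compat_r; first exact: Rabs_pos.
  apply: Rle_trans (gf n) _; apply: Rmult_le_compat_l; first exact: Rabs_pos.
  exact: Rle_abs.
have [ub _] := Lub_Rbar_correct (CV_disk g).
have := ub q gq; rewrite -/(CV_radius g).
by apply: Rbar_lt_le_trans.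
Qed.

Lemma re_coef_radius f c :
  Rbar_lt (Cmod c) (CV_radius f) -> Rbar_lt 1 (CV_radius (re_coef f c)).
Proof.
move=> cf; apply: (CV_radius_gt1 (Cmod_ge_0 c) cf) => n.
rewrite Rabs_mult -Cmod_pow; apply: Rmult_le_compat_l; first exact: Rabs_pos.
exact: re_le_Cmod.
Qed.

Lemma im_coef_radius f c :
  Rbar_lt (Cmod c) (CV_radius f) -> Rbar_lt 1 (CV_radius (im_coef f c)).
Proof.
move=> cf; apply: (CV_radius_gt1 (Cmod_ge_0 c) cf) => n.
rewrite Rabs_mult -Cmod_pow; apply: Rmult_le_compat_l; first exact: Rabs_pos.
exact: im_le_Cmod.
Qed.

Lemma Rbar_lt_Rabs1 x : Rbar_lt 1 x -> Rbar_lt (Rabs 1) x.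
Proof. by rewrite Rabs_R1. Qed.

Lemma re_coef_cv f c : Rbar_lt (Cmod c) (CV_radius f) -> ex_pseries (re_coef f c) 1.
Proof. by move=> cf; apply/CV_radius_inside/Rbar_lt_Rabs1/re_coef_radius. Qed.
Lemma im_coef_cv f c : Rbar_lt (Cmod c) (CV_radius f) -> ex_pseries (im_coef f c) 1.
Proof. by move=> cf; apply/CV_radius_inside/Rbar_lt_Rabs1/im_coef_radius. Qed.

Lemma ev_ext f g c : (forall n, f n = g n) -> ev f c = ev g c.
Proof.
by move=> fg; congr pair; apply: PSeries_ext => n; rewrite /re_coef /im_coef fg.
Qed.

Lemma ev_plus f g c :
  Rbar_lt (Cmod c) (CV_radius f) -> Rbar_lt (Cmod c) (CV_radius g) ->
  ev (fun n => f n + g n) c = (ev f c + ev g c)%C.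
Proof.
move=> cf cg; congr pair; rewrite -PSeries_plus;
  try by [apply: re_coef_cv|apply: im_coef_cv].
all: apply: PSeries_ext => n; rewrite /PS_plus /plus /= /re_coef /im_coef; ring.
Qed.

Lemma ev_scal k f c : ev (fun n => k * f n) c = (k * ev f c)%C.
Proof.
rewrite /ev /Cmult /= !Rmult_0_l Rminus_0_r Rplus_0_r.
congr pair; rewrite -PSeries_scal; apply: PSeries_ext => n;
 rewrite /PS_scal /scal /= /mult /= /re_coef /im_coef; ring.
Qed.

Definition delta (k : nat) (x : R) (n : nat) : R := if n == k then x else 0.

Lemma sum_n_delta k x n : sum_n (delta k x) n = if (k <= n)%N then x else 0.
Proof.
elim: n => [|n IHn]; first by rewrite sum_O /delta leqn0 eq_sym.
rewrite sum_Sn IHn /delta /plus /= [in RHS]leq_eqVlt ltnS eq_sym.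
by case: eqP => [->|_] /=; rewrite ?ltnn; [ring | case: ifP => _; ring].
Qed.

Lemma is_series_delta k x : is_series (delta k x) x.
Proof.
apply: (filterlim_ext_loc (fun => x)); last exact: filterlim_const.
by exists k => n /leP kn; rewrite sum_n_delta kn.
Qed.

Lemma delta_pow k x t n : delta k x n * t ^ n = delta k (x * t ^ k) n.
Proof. by rewrite /delta; case: eqP => [->|_]; ring. Qed.

Lemma delta_radius k x (r : R) : Rbar_lt r (CV_radius (delta k x)).
Proof.
have [ub _] := Lub_Rbar_correct (CV_disk (delta k x)).
apply: (@Rbar_lt_le_trans _ (r + 1)); first by move=> /=; lra.
apply: ub; exists (Rabs (x * (r + 1) ^ k)).
refine (is_series_ext (delta k _) _ _ _ (@is_series_delta k _)) => n.
rewrite delta_pow /delta; case: ifP => _ //; by rewrite Rabs_R0.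
Qed.

Lemma ev_delta k x c : ev (delta k x) c = (x * c ^ k)%C.
Proof.
rewrite /ev /Cmult /= !Rmult_0_l Rminus_0_r Rplus_0_r.
congr pair; apply: is_pseries_unique.
  refine (is_series_ext (delta k _) _ _ _ (@is_series_delta k _)) => n.
  rewrite pow_n_pow pow1 /scal /= /mult /= /re_coef /delta Rmult_1_l.
  by case: eqP => [->|_] //; rewrite Rmult_0_l.
refine (is_series_ext (delta k _) _ _ _ (@is_series_delta k _)) => n.
rewrite pow_n_pow pow1 /scal /= /mult /= /im_coef /delta Rmult_1_l.
by case: eqP => [->|_] //; rewrite Rmult_0_l.
Qed.

Lemma Cpow_split (c : C) i n :
  (i <= n)%N -> (c ^ n)%C = (c ^ i * c ^ (n - i)%coq_nat)%C.
Proof. by move=> lein; rewrite -Cpow_add_r plusE minusE subnKC. Qed.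

Lemma re_coef_mult f g c n :
  re_coef (PS_mult f g) c n =
  PS_mult (re_coef f c) (re_coef g c) n - PS_mult (im_coef f c) (im_coef g c) n.
Proof.
rewrite /re_coef /PS_mult Rmult_comm scal_sum -minus_sum.
apply: PartSum.sum_eq => i /leP lein; rewrite /im_coef.
by rewrite (Cpow_split c lein) /Re /Im /=; ring.
Qed.

Lemma im_coef_mult f g c n :
  im_coef (PS_mult f g) c n =
  PS_mult (re_coef f c) (im_coef g c) n + PS_mult (im_coef f c) (re_coef g c) n.
Proof.
rewrite /im_coef /PS_mult Rmult_comm scal_sum -plus_sum.
apply: PartSum.sum_eq => i /leP lein; rewrite /re_coef.
by rewrite (Cpow_split c lein) /Re /Im /=; ring.
Qed.

Lemma ev_mult f g c :
  Rbar_lt (Cmod c) (CV_radius f) -> Rbar_lt (Cmod c) (CV_radius g) ->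
  ev (PS_mult f g) c = (ev f c * ev g c)%C.
Proof.
move=> cf cg.
have [rf jf] := (Rbar_lt_Rabs1 (re_coef_radius cf), Rbar_lt_Rabs1 (im_coef_radius cf)).
have [rg jg] := (Rbar_lt_Rabs1 (re_coef_radius cg), Rbar_lt_Rabs1 (im_coef_radius cg)).
rewrite /ev /Cmult /=; congr pair.
  rewrite -!PSeries_mult // -PSeries_minus; try exact: ex_pseries_mult.
  by apply: PSeries_ext => n; rewrite re_coef_mult.
rewrite -!PSeries_mult // -PSeries_plus; try exact: ex_pseries_mult.
by apply: PSeries_ext => n; rewrite im_coef_mult.
Qed.

Lemma Cpow_ray (t : R) (c : C) n :
  ((t * c) ^ n)%C = (t ^ n * Re (c ^ n)%C, t ^ n * Im (c ^ n)%C).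
Proof.
rewrite Cpow_mult_l -RtoC_pow /Cmult /=.
by congr pair; rewrite /Re /Im; ring.
Qed.

Lemma ev_ray f (t : R) c :
  ev f (t * c)%C = (PSeries (re_coef f c) t, PSeries (im_coef f c) t).
Proof.
rewrite /ev; congr pair; apply: Series_ext => n;
 rewrite /re_coef /im_coef Cpow_ray pow1 /Re /Im /=; ring.
Qed.

Lemma Cmod_ray (t : R) c : Rabs t <= 1 -> Cmod (t * c)%C <= Cmod c.
Proof.
move=> t1; rewrite Cmod_mult Cmod_R -{2}[Cmod c]Rmult_1_l.
by apply: Rmult_le_compat_r => //; apply: Cmod_ge_0.
Qed.

Section Ray.
Variables (f : nat -> R) (c : C) (t : R).
Hypothesis cf : Rbar_lt (Cmod c) (CV_radius f).
Hypothesis t1 : Rabs t <= 1.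

Lemma re_ev_derive :
  is_derive (fun t : R => Re (ev f (t * c)%C)) t
    (Re (c * ev (PS_derive f) (t * c)%C)%C).
Proof.
apply: (is_derive_ext (PSeries (re_coef f c))).
  by move=> s; rewrite ev_ray.
have cd : Rbar_lt (Cmod c) (CV_radius (PS_derive f)) by rewrite CV_radius_derive.
have tr g : Rbar_lt 1 (CV_radius g) -> Rbar_lt (Rabs t) (CV_radius g).
  by apply: Rbar_le_lt_trans.
have -> : Re (c * ev (PS_derive f) (t * c)%C)%C = PSeries (PS_derive (re_coef f c)) t.
  rewrite ev_ray /Cmult /= -!PSeries_scal -PSeries_minus.
  - apply: PSeries_ext => n.
    rewrite /PS_minus /PS_plus /PS_opp /PS_scal /PS_derive /re_coef /im_coef.
    by rewrite /plus /Hierarchy.opp /scal /= /mult /= /Re /Im; ring.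
  - by apply: ex_pseries_scal; [apply: Rmult_comm|apply/CV_radius_inside/tr/re_coef_radius].
  - by apply: ex_pseries_scal; [apply: Rmult_comm|apply/CV_radius_inside/tr/im_coef_radius].
by apply/is_derive_PSeries/tr/re_coef_radius.
Qed.

Lemma im_ev_derive :
  is_derive (fun t : R => Im (ev f (t * c)%C)) t
    (Im (c * ev (PS_derive f) (t * c)%C)%C).
Proof.
apply: (is_derive_ext (PSeries (im_coef f c))).
  by move=> s; rewrite ev_ray.
have cd : Rbar_lt (Cmod c) (CV_radius (PS_derive f)) by rewrite CV_radius_derive.
have tr g : Rbar_lt 1 (CV_radius g) -> Rbar_lt (Rabs t) (CV_radius g).
  by apply: Rbar_le_lt_trans.
have -> : Im (c * ev (PS_derive f) (t * c)%C)%C = PSeries (PS_derive (im_coef f c)) t.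
  rewrite ev_ray /Cmult /= -!PSeries_scal -PSeries_plus.
  - apply: PSeries_ext => n.
    rewrite /PS_plus /PS_scal /PS_derive /re_coef /im_coef.
    by rewrite /plus /scal /= /mult /= /Re /Im; ring.
  - by apply: ex_pseries_scal; [apply: Rmult_comm|apply/CV_radius_inside/tr/im_coef_radius].
  - by apply: ex_pseries_scal; [apply: Rmult_comm|apply/CV_radius_inside/tr/re_coef_radius].
by apply/is_derive_PSeries/tr/im_coef_radius.
Qed.

End Ray.

(** * Cauchy's estimate for power series *)

Definition circle (r th : R) : C := (r * cos th, r * sin th).

Lemma Cmod_circle r th : 0 <= r -> Cmod (circle r th) = r.
Proof.
move=> r0; rewrite /Cmod /circle /=.
have -> : r * cos th * (r * cos th * 1) + r * sin th * (r * sin th * 1)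
   = r ^ 2 * ((sin th)² + (cos th)²) by rewrite /Rsqr; ring.
by rewrite sin2_cos2 Rmult_1_r sqrt_pow2.
Qed.

Lemma circle_pow r th k :
  (circle r th ^ k)%C = (r ^ k * cos (INR k * th), r ^ k * sin (INR k * th)).
Proof.
elim: k => [|k IHk]; first by rewrite /= Rmult_0_l cos_0 sin_0; congr pair; ring.
rewrite Cpow_S IHk S_INR Rmult_plus_distr_r Rmult_1_l cos_plus sin_plus.
by rewrite /Cmult /circle /=; congr pair; ring.
Qed.

Lemma is_series_sum_f_R0 (h : nat -> nat -> R) (L : nat -> R) m :
  (forall j, is_series (h j) (L j)) ->
  is_series (fun k => sum_f_R0 (fun j => h j k) m) (sum_f_R0 L m).
Proof.
move=> hL; elim: m => [|m IHm] //=.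
exact: (is_series_plus _ _ _ _ IHm (hL _)).
Qed.

Lemma sum_cos (x : R) m :
  2 * sin x * sum_f_R0 (fun j => cos (INR j * (2 * x))) m
  = sin ((2 * INR m + 1) * x) + sin x.
Proof.
elim: m => [|m IHm].
  by rewrite /= Rmult_0_l cos_0 Rmult_0_r Rplus_0_l Rmult_1_l; ring.
rewrite tech5 Rmult_plus_distr_l IHm S_INR.
have -> : (2 * (INR m + 1) + 1) * x = (INR m + 1) * (2 * x) + x by ring.
have -> : (2 * INR m + 1) * x = (INR m + 1) * (2 * x) - x by ring.
by rewrite sin_plus sin_minus; ring.
Qed.

(** The real part of the vanishing sum of the [d]-th powers of the
    [(m + 1)]-st roots of unity; the sum telescopes after multiplication by
    [2 sin x], where [x = pi d / (m + 1)]. *)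
Lemma sum_cos_root_of_unity d m : (0 < d <= m)%N ->
  sum_f_R0 (fun j => cos (INR d * (INR j * (2 * PI / INR m.+1)))) m = 0.
Proof.
case/andP=> d0 dm; have m0 : 0 < INR m.+1 by apply: lt_0_INR; apply/ltP.
pose x := PI * (INR d / INR m.+1).
have x_gt0 : 0 < x.
  apply: Rmult_lt_0_compat; first exact: PI_RGT_0.
  by apply: Rdiv_lt_0_compat => //; apply: lt_0_INR; apply/ltP.
have x_ltpi : x < PI.
  rewrite /x -{2}[PI]Rmult_1_r; apply: Rmult_lt_compat_l; first exact: PI_RGT_0.
  apply/Rlt_div_l => //; rewrite Rmult_1_l.
  by apply: lt_INR; apply/ltP.
have s0 : 0 < sin x by apply: sin_gt_0.
apply: (Rmult_eq_reg_l (2 * sin x)); last lra.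
rewrite (PartSum.sum_eq _ (fun j => cos (INR j * (2 * x)))); last first.
  by move=> j _; congr cos; rewrite /x; field; lra.
rewrite sum_cos Rmult_0_r.
have -> : (2 * INR m + 1) * x = - x + 2 * INR d * PI.
  by rewrite /x; move: m0; rewrite S_INR => m0; field; lra.
by rewrite sin_period sin_neg; ring.
Qed.

Lemma sum_cos_difference k n m : (k <= m)%N -> (n <= m)%N ->
  sum_f_R0 (fun j => cos ((INR k - INR n) * (INR j * (2 * PI / INR m.+1)))) m
  = if k == n then INR m.+1 else 0.
Proof.
move=> km nm; case: eqP => [->|/eqP].
  rewrite (PartSum.sum_eq _ (fun=> 1)).
    by rewrite sum_cte Rmult_1_l.
  by move=> j _; rewrite Rminus_diag Rmult_0_l cos_0.
rewrite neq_ltn => /orP[kn|nk].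
  rewrite -(@sum_cos_root_of_unity (n - k) m).
    apply: PartSum.sum_eq => j _; rewrite -cos_neg; congr cos.
    by rewrite -minusE minus_INR; [ring|apply/leP/ltnW].
  by rewrite subn_gt0 kn /= (leq_trans (leq_subr _ _)).
rewrite -(@sum_cos_root_of_unity (k - n) m).
  apply: PartSum.sum_eq => j _; congr cos.
  by rewrite -minusE minus_INR; [ring|apply/leP/ltnW].
by rewrite subn_gt0 nk /= (leq_trans (leq_subr _ _)).
Qed.

(** The real part of [e^{-i n th} f(r e^{i th})]. *)
Lemma is_series_circle f r th n : 0 <= r -> Rbar_lt r (CV_radius f) ->
  is_series (fun k => f k * r ^ k * cos ((INR k - INR n) * th))
    (Re (ev f (circle r th) * circle 1 (- (INR n * th)))%C).
Proof.
move=> r0 rf; have cf : Rbar_lt (Cmod (circle r th)) (CV_radius f).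
  by rewrite Cmod_circle.
have sr := PSeries_correct _ _ (re_coef_cv cf).
have si := PSeries_correct _ _ (im_coef_cv cf).
rewrite /Re /Cmult /= cos_neg sin_neg !Rmult_1_l.
have := is_series_plus _ _ _ _ (is_series_scal_r (cos (INR n * th)) _ _ sr)
  (is_series_scal_r (sin (INR n * th)) _ _ si).
rewrite /plus /= => S; have -> : forall a b c s : R, a * c - b * - s = a * c + b * s.
  by move=> *; ring.
refine (is_series_ext _ _ _ _ S) => k.
rewrite !pow_n_pow !pow1 /scal /= /mult /= /plus /= /re_coef /im_coef circle_pow.
rewrite Rmult_minus_distr_r cos_minus /Re /Im /=; ring.
Qed.

Lemma sum_f_R0_if (k m : nat) x : (k <= m)%N ->
  sum_f_R0 (fun i => if i == k then x else 0) m = x.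
Proof. by move=> km; rewrite -sum_n_Reals -/(delta k x) sum_n_delta km. Qed.

(** Averaging over the [(m + 1)]-st roots of unity isolates the [n]-th
    coefficient among the first [m + 1], and the remaining ones contribute at
    most the tail of the absolutely convergent series, which tends to 0 with
    growing [m]. *)
Lemma cauchy_estimate f r M n : 0 <= r -> Rbar_lt r (CV_radius f) ->
  (forall c, Cmod c = r -> Cmod (ev f c) <= M) -> Rabs (f n) * r ^ n <= M.
Proof.
move=> r0 rf evM.
pose A k := Rabs (f k * r ^ k).
have cvA : ex_series A by apply: CV_disk_inside; rewrite Rabs_pos_eq.
have bound m : (n <= m)%N -> Rabs (f n) * r ^ n <= M + (Series A - sum_f_R0 A m).
  move=> nm; pose N := INR m.+1.
  have N0 : 0 < N by apply: lt_0_INR; apply/ltP.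
  pose th j := INR j * (2 * PI / N).
  pose L j := Re (ev f (circle r (th j)) * circle 1 (- (INR n * th j)))%C.
  pose g k := sum_f_R0 (fun j => f k * r ^ k * cos ((INR k - INR n) * th j)) m / N.
  have gS : is_series g (sum_f_R0 L m / N).
    apply: is_series_scal_r; apply: is_series_sum_f_R0 => j.
    exact: is_series_circle.
  have LM j : Rabs (L j) <= M.
    apply: Rle_trans (re_le_Cmod _) _; rewrite Cmod_mult.
    rewrite [Cmod (circle 1 _)]Cmod_circle; last lra.
    by rewrite Rmult_1_r; apply: evM; apply: Cmod_circle.
  have meanM : Rabs (sum_f_R0 L m / N) <= M.
    rewrite Rabs_div; last lra.
    rewrite (Rabs_pos_eq N); last lra.
    apply/Rle_div_l => //; apply: Rle_trans (Rsum_abs _ _) _.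
    by rewrite /N -sum_cte; apply: sum_Rle => j _; apply: LM.
  have gE k : g k = f k * r ^ k * (sum_f_R0 (fun j => cos ((INR k - INR n) * th j)) m / N).
    rewrite /g; rewrite (PartSum.sum_eq _ (fun j => cos ((INR k - INR n) * th j) * (f k * r ^ k))).
      by rewrite -scal_sum; field; lra.
    by move=> j _; ring.
  have gA k : Rabs (g k) <= A k.
    rewrite gE Rabs_mult -[A k]Rmult_1_r; apply: Rmult_le_compat_l; first exact: Rabs_pos.
    rewrite Rabs_div; last lra.
    rewrite (Rabs_pos_eq N); last lra.
    apply/Rle_div_l => //; apply: Rle_trans (Rsum_abs _ _) _.
    rewrite /N -sum_cte; apply: sum_Rle => j _.
    by apply: Rabs_le; apply: COS_bound.
  have head : sum_f_R0 g m = f n * r ^ n.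
    rewrite (PartSum.sum_eq _ (fun k => if k == n then f n * r ^ n else 0)).
      exact: sum_f_R0_if.
    move=> k /leP km; rewrite gE sum_cos_difference //.
    by case: eqP => [->|_]; rewrite -/N; field; lra.
  have cvg : ex_series g by exists (sum_f_R0 L m / N).
  have := is_series_unique _ _ gS; rewrite (Series_incr_n g m.+1) //=; last exact/ltP.
  rewrite head => E.
  have tailA : Series A - sum_f_R0 A m = Series (fun k => A (m + k)%coq_nat.+1).
    by rewrite (Series_incr_n A m.+1) //=; [ring|apply/ltP].
  have cvtail : ex_series (fun k => A (m + k)%coq_nat.+1).
    by have := proj1 (ex_series_incr_n A m.+1) cvA.
  have tail : Rabs (Series (fun k => g (m + k)%coq_nat.+1)) <= Series (fun k => A (m + k)%coq_nat.+1).
    apply: Rle_trans (Series_Rabs _ _) _.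
      apply: ex_series_le cvtail => k; rewrite /norm /= /abs /= Rabs_Rabsolu.
      exact: gA.
    by apply: Series_le => // k; split; [apply: Rabs_pos|apply: gA].
  rewrite tailA; have -> : Rabs (f n) * r ^ n = Rabs (f n * r ^ n).
    by rewrite Rabs_mult (Rabs_pos_eq (r ^ n)) //; apply: pow_le.
  have -> : f n * r ^ n = sum_f_R0 L m / N - Series (fun k => g (m + k)%coq_nat.+1).
    by rewrite -E; ring.
  apply: Rle_trans (Rabs_triang _ _) _; rewrite Rabs_Ropp; lra.
apply: le_epsilon => eps eps0.
have lim : is_lim_seq (sum_n A) (Series A) by exact: Series_correct cvA.
have [m0 /= mP] := proj2 (is_lim_seq_spec _ _) lim (mkposreal eps eps0).
have nm : (n <= maxn n m0)%N by apply: leq_maxl.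
have /leP m0m : (m0 <= maxn n m0)%N by apply: leq_maxr.
have := bound _ nm; have := mP _ m0m; rewrite sum_n_Reals => /Rabs_def2; lra.
Qed.

(** * Hasse derivatives *)

Section Hasse.
Import Order.TTheory GRing.Theory Num.Theory.
Local Open Scope ring_scope.
Variable F : numFieldType.
Implicit Types f g : nat -> F.

(** The Taylor coefficient of order [k] at a moving base point. *)
Definition fhasse k f n := f (n + k)%N *+ 'C(n + k, k).

Lemma fderiv_fhasse k f n : fderiv (fhasse k f) n = fhasse k.+1 f n *+ k.+1.
Proof.
rewrite /fderiv /fhasse -!mulrnA addSnnS; congr (_ *+ _).
by rewrite [RHS]mulnC mul_bin_left addnS -addSn addnK mulnC.
Qed.

Lemma fhasse_fderiv k f n : fhasse k (fderiv f) n = fhasse k.+1 f n *+ k.+1.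
Proof.
rewrite /fderiv /fhasse -!mulrnA addnS; congr (_ *+ _).
by rewrite [RHS]mulnC -mul_bin_diag.
Qed.

(** Leibniz rule for Hasse derivatives; induction on [k] by differentiating
    both sides, as in [conv_fderiv]. *)
Lemma conv_fhasse k f g n :
  \sum_(i < k.+1) conv (fhasse i f) (fhasse (k - i) g) n = fhasse k (conv f g) n.
Proof.
elim: k n => [|k IHk] n.
  rewrite big_ord1 subnn /fhasse addn0 bin0 mulr1n.
  by apply: eq_conv => m; rewrite addn0 bin0.
suff /eqP : (\sum_(i < k.+2) conv (fhasse i f) (fhasse (k.+1 - i) g) n) *+ k.+1
   = fhasse k.+1 (conv f g) n *+ k.+1.
  by rewrite -subr_eq0 -mulrnBl mulrn_eq0 /= subr_eq0 => /eqP.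
rewrite -fderiv_fhasse -(eq_fderiv IHk) /fderiv -!sumrMnl.
transitivity (\sum_(i < k.+1) (conv (fderiv (fhasse i f)) (fhasse (k - i) g) n
   + conv (fhasse i f) (fderiv (fhasse (k - i) g)) n)); last first.
  by apply: eq_bigr => i _; rewrite -conv_fderiv.
rewrite big_split /=.
have cMl p q m : conv (fun j => p j *+ m) q n = conv p q n *+ m.
  by rewrite /conv -sumrMnl; apply: eq_bigr => i _; rewrite mulrnAl.
have cMr p q m : conv p (fun j => q j *+ m) n = conv p q n *+ m.
  by rewrite /conv -sumrMnl; apply: eq_bigr => i _; rewrite mulrnAr.
transitivity (\sum_(i < k.+2) conv (fhasse i f) (fhasse (k.+1 - i) g) n *+ i
  + \sum_(i < k.+2) conv (fhasse i f) (fhasse (k.+1 - i) g) n *+ (k.+1 - i)).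
  rewrite -big_split; apply: eq_bigr => i _ /=.
  by rewrite -mulrnDr subnKC // -ltnS.
congr (_ + _).
  rewrite big_ord_recl /= mulr0n add0r; apply: eq_bigr => i _.
  by rewrite (eq_conv (fderiv_fhasse i f) (frefl _)) cMl /bump /= add1n subSS.
rewrite big_ord_recr /= subnn mulr0n addr0; apply: eq_bigr => i _.
rewrite (eq_conv (frefl _) (fderiv_fhasse _ g)) cMr -subSn //.
by rewrite -ltnS.
Qed.

Lemma convC f g n : conv f g n = conv g f n.
Proof.
rewrite /conv (reindex_inj rev_ord_inj) /=; apply: eq_bigr => i _.
by rewrite subSS subKn -1?ltnS // mulrC.
Qed.

End Hasse.

Section RealSequences.
Import Order.TTheory GRing.Theory Num.Theory.

Lemma PS_multE (f g : nat -> R) n : PS_mult f g n = conv f g n.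
Proof. by rewrite /PS_mult sum_f_R0E big_mkord. Qed.

Lemma PS_deriveE (f : nat -> R) n : PS_derive f n = fderiv f n.
Proof. by rewrite /PS_derive /fderiv INRE RmultE mulr_natl. Qed.

Local Open Scope R_scope.

(** [fhasse] over the reals, with the scaling written as a product so that the
    lemmas on real power series apply to it. *)
Definition hasse (k : nat) (f : nat -> R) (n : nat) : R :=
  INR 'C(n + k, k) * f (n + k)%N.

Lemma hasseE k f n : hasse k f n = fhasse k f n.
Proof. by rewrite /hasse /fhasse INRE RmultE mulr_natl. Qed.

Lemma PS_multC f g n : PS_mult f g n = PS_mult g f n.
Proof. by rewrite !PS_multE convC. Qed.

Lemma eq_PS_mult f f' g g' n : f =1 f' -> g =1 g' ->
  PS_mult f g n = PS_mult f' g' n.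
Proof. by move=> ef eg; rewrite !PS_multE (eq_conv ef eg). Qed.

Lemma PS_derive_mult f g n :
  PS_derive (PS_mult f g) n =
  PS_mult (PS_derive f) g n + PS_mult f (PS_derive g) n.
Proof.
rewrite PS_deriveE (eq_fderiv (PS_multE f g)) conv_fderiv !PS_multE.
by congr (_ + _); apply: eq_conv => // m; rewrite PS_deriveE.
Qed.

Lemma hasse_mult k f g n :
  hasse k (PS_mult f g) n =
  sum_f_R0 (fun i => PS_mult (hasse i f) (hasse (k - i) g) n) k.
Proof.
rewrite hasseE sum_f_R0E big_mkord /fhasse PS_multE -/(fhasse k (conv f g) n).
rewrite -conv_fhasse; apply: eq_bigr => i _; rewrite PS_multE.
by apply: eq_conv => m; rewrite hasseE.
Qed.

Lemma hasse_derive k f n :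
  hasse k (PS_derive f) n = INR k.+1 * hasse k.+1 f n.
Proof.
rewrite !hasseE INRE RmultE mulr_natl -fhasse_fderiv /fhasse.
by rewrite PS_deriveE.
Qed.

Lemma derive_hasse k f n :
  PS_derive (hasse k f) n = INR k.+1 * hasse k.+1 f n.
Proof.
rewrite PS_deriveE (eq_fderiv (hasseE k f)) hasseE INRE RmultE mulr_natl.
by rewrite fderiv_fhasse.
Qed.

End RealSequences.

Local Open Scope R_scope.

Lemma hasse_radius k f : CV_radius (hasse k f) = CV_radius f.
Proof.
elim: k => [|k IHk].
  by apply: CV_radius_ext => n; rewrite /hasse addn0 bin0 Rmult_1_l.
rewrite -IHk -[RHS]CV_radius_derive -(@CV_radius_scal (INR k.+1) (hasse k.+1 f)).
  by apply: CV_radius_ext => n; rewrite derive_hasse.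
exact: not_0_INR.
Qed.

(** * A majorant for the Riccati recursion *)

Lemma sum_f_R0_rev (h : nat -> R) m : sum_f_R0 (fun i => h (m - i)%N) m = sum_f_R0 h m.
Proof.
have := PS_multC h (fun=> 1) m; rewrite /PS_mult => E.
rewrite -(PartSum.sum_eq (fun i => 1 * h (m - i)%coq_nat)); last by move=> i _; rewrite Rmult_1_l.
by rewrite -E; apply: PartSum.sum_eq => i _; rewrite Rmult_1_r.
Qed.

Lemma sum_inv_squares m : sum_f_R0 (fun i => / INR i.+1 ^ 2) m <= 2 - / INR m.+1.
Proof.
elim: m => [|m IHm]; first by rewrite /=; lra.
rewrite tech5; have m0 : 0 < INR m.+1 by apply: lt_0_INR; apply/ltP.
apply: (@Rle_trans _ (2 - / INR m.+1 + / INR m.+2 ^ 2)); first lra.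
rewrite (S_INR m.+1); move: m0; move: (INR m.+1) => x x0.
have -> : 2 - / (x + 1) = 2 - / x + / (x * (x + 1)) by field; lra.
apply: Rplus_le_compat_l; apply: Rinv_le_contravar; nra.
Qed.

(** For [p + q = N] one has [1/(p q) = (1/p + 1/q)/N], whose square is at most
    [2 (1/p^2 + 1/q^2)/N^2]; hence convolution preserves the order [1/N^2]. *)
Lemma sum_inv_squares_conv m :
  sum_f_R0 (fun i => / INR i.+1 ^ 2 * / INR (m - i).+1 ^ 2) m <= 8 / INR m.+2 ^ 2.
Proof.
pose N := INR m.+2; have N0 : 0 < N by apply: lt_0_INR; apply/ltP.
pose h i := / INR i.+1 ^ 2.
apply: (@Rle_trans _ (2 / N ^ 2 * (sum_f_R0 h m + sum_f_R0 (fun i => h (m - i)%N) m))).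
  rewrite -plus_sum scal_sum; apply: sum_Rle => i /leP im.
  have -> : N = INR i.+1 + INR (m - i).+1.
    by rewrite -plus_INR /N; congr INR; rewrite plusE addSn addnS subnKC.
  rewrite /h; have : 0 < INR i.+1 by apply: lt_0_INR; apply/ltP.
  have : 0 < INR (m - i).+1 by apply: lt_0_INR; apply/ltP.
  move: (INR _) (INR _) => p q q0 p0.
  have -> : / p ^ 2 * / q ^ 2 = (/ p + / q) ^ 2 / (p + q) ^ 2 by field; lra.
  have -> : (/ p ^ 2 + / q ^ 2) * (2 / (p + q) ^ 2)
    = (2 * ((/ p) ^ 2 + (/ q) ^ 2)) / (p + q) ^ 2 by field; lra.
  apply: Rmult_le_compat_r.
    by apply/Rlt_le/Rinv_0_lt_compat; nra.
  by have := pow2_ge_0 (/ p - / q); lra.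
rewrite sum_f_R0_rev; have := sum_inv_squares m; rewrite -/h => hs.
have : 0 < / INR m.+1 by apply/Rinv_0_lt_compat/lt_0_INR/ltP.
have : 0 < / N ^ 2 by apply: Rinv_0_lt_compat; nra.
rewrite /Rdiv -/N; nra.
Qed.

(** The weight [1/k^2] absorbs the quadratic term by [sum_inv_squares_conv].
    The prefactor [d/8] makes that term half of the target, and [B = (4 + 8 M)/d]
    covers both the linear term, which needs [d B >= 4], and the initial bound,
    which needs [d B >= 8 M]. *)
Lemma riccati_majorant (x : nat -> R) (d M : R) :
  0 < d -> (forall k, 0 <= x k) -> x 1%N <= M ->
  (forall k, d * x k.+2 <= x k.+1 / INR k.+2
      + / 2 * sum_f_R0 (fun i => x i.+1 * x (k - i).+1) k) ->
  forall k, x k.+1 <= d / 8 * ((4 + 8 * M) / d) ^ k.+1 / INR k.+1 ^ 2.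
Proof.
move=> d0 x0 x1 rec.
have M0 : 0 <= M by apply: Rle_trans (x0 1%N) x1.
pose B := (4 + 8 * M) / d; rewrite -/B.
have dB : d * B = 4 + 8 * M by rewrite /B; field; lra.
have B0 : 0 < B by apply: Rdiv_lt_0_compat; lra.
suff H k : forall j, (j <= k)%N -> x j.+1 <= d / 8 * B ^ j.+1 / INR j.+1 ^ 2.
  by move=> k; apply: (H k).
elim: k => [|k IHk] j; first by rewrite leqn0 => /eqP->; rewrite /=; nra.
rewrite leq_eqVlt ltnS => /orP[/eqP->{j}|]; last exact: IHk.
have INR0 i : 0 < INR i.+1 by apply: lt_0_INR; apply/ltP.
have Bn i : 0 < B ^ i by apply: pow_lt.
apply: (Rmult_le_reg_l d) => //; apply: Rle_trans (rec k) _.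
have sumle : sum_f_R0 (fun i => x i.+1 * x (k - i).+1) k
    <= (d / 8) ^ 2 * B ^ k.+2 * (8 / INR k.+2 ^ 2).
  apply: (@Rle_trans _ ((d / 8) ^ 2 * B ^ k.+2 * sum_f_R0 (fun i => / INR i.+1 ^ 2 * / INR (k - i).+1 ^ 2) k)).
    rewrite scal_sum; apply: sum_Rle => i /leP ik.
    have := Rmult_le_compat _ _ _ _ (x0 _) (x0 _) (IHk _ ik) (IHk _ (leq_subr i k)).
    move=> le; apply: Rle_trans le _; apply: Req_le.
    have -> : B ^ k.+2 = B ^ i.+1 * B ^ (k - i).+1.
      by rewrite -pow_add; congr pow; rewrite plusE addSn addnS subnKC.
    by have := (INR0 i, INR0 (k - i)%N) => -[] *; field; lra.
  apply: Rmult_le_compat_l; last exact: sum_inv_squares_conv.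
  by apply: Rmult_le_pos; [apply: pow2_ge_0|apply: Rlt_le].
have xk : x k.+1 / INR k.+2 <= d / 8 * B ^ k.+1 / INR k.+1 ^ 2 / INR k.+2.
  apply: Rmult_le_compat_r; last exact: IHk.
  by apply/Rlt_le/Rinv_0_lt_compat.
apply: Rle_trans (Rplus_le_compat _ _ _ _ xk (Rmult_le_compat_l (/ 2) _ _ _ sumle)) _; first lra.
have [m0 m1] : 0 < INR k.+1 /\ 1 <= INR k.+1.
  by split=> //; rewrite S_INR; have := pos_INR k; lra.
rewrite (S_INR k.+1) -!tech_pow_Rmult.
move: m0 m1 (Bn k); move: (INR k.+1) (B ^ k) => m b m0 m1 b0.
have -> : d * (d / 8 * (B * (B * b)) / (m + 1) ^ 2)
  = d / 8 * (B * b) / (m + 1) ^ 2 * (d * B) by field; lra.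
have -> : d / 8 * (B * b) / m ^ 2 / (m + 1)
  + / 2 * ((d / 8) ^ 2 * (B * (B * b)) * (8 / (m + 1) ^ 2))
  = d / 8 * (B * b) / (m + 1) ^ 2 * ((m + 1) / m ^ 2 + d * B / 2) by field; lra.
apply: Rmult_le_compat_l.
  apply: Rmult_le_pos; last by apply/Rlt_le/Rinv_0_lt_compat; nra.
  by apply: Rmult_le_pos; nra.
have : (m + 1) / m ^ 2 <= 2 by apply/Rle_div_l; nra.
lra.
Qed.

(** * Sums and products inside the disc of convergence *)

Lemma CV_radius_plus_lt f g (r : R) :
  Rbar_lt r (CV_radius f) -> Rbar_lt r (CV_radius g) ->
  Rbar_lt r (CV_radius (fun n => f n + g n)).
Proof.
move=> rf rg; refine (Rbar_lt_le_trans _ _ _ _ (CV_radius_plus f g)).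
exact: Rbar_min_case.
Qed.

Lemma CV_radius_scal_lt k f (r : R) :
  Rbar_lt r (CV_radius f) -> Rbar_lt r (CV_radius (fun n => k * f n)).
Proof.
move=> rf; case: (Req_dec k 0) => [->|k0]; last by rewrite (CV_radius_scal k f k0).
rewrite (CV_radius_ext _ (delta 0 0)); first exact: delta_radius.
by move=> n; rewrite /delta; case: ifP => _; ring.
Qed.

Lemma CV_radius_mult_lt f g (r : R) : 0 <= r ->
  Rbar_lt r (CV_radius f) -> Rbar_lt r (CV_radius g) ->
  Rbar_lt r (CV_radius (PS_mult f g)).
Proof.
move=> r0 /Rbar_lt_between[s1 [rs1 s1f]] /Rbar_lt_between[s2 [rs2 s2g]].
pose s := Rmin s1 s2; have rs : r < s by apply: Rmin_glb_lt.
have sf : Rbar_lt s (CV_radius f) by apply: Rbar_le_lt_trans s1f; apply: Rmin_l.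
have sg : Rbar_lt s (CV_radius g) by apply: Rbar_le_lt_trans s2g; apply: Rmin_r.
apply: (@Rbar_lt_le_trans _ s) => //.
case: (Rbar_le_lt_dec s (CV_radius (PS_mult f g))) => // lt.
have sE : Rabs s = s by apply: Rabs_pos_eq; lra.
case: (@CV_disk_outside (PS_mult f g) s); first by rewrite sE.
apply: ex_series_lim_0; have := @ex_pseries_mult f g s; rewrite sE => /(_ sf sg).
case=> l H; exists l; refine (is_series_ext _ _ _ _ H) => n.
by rewrite pow_n_pow /scal /= /mult /= Rmult_comm.
Qed.

Lemma ev_sum (F : nat -> nat -> R) c m :
  (forall i, Rbar_lt (Cmod c) (CV_radius (F i))) ->
  ev (fun n => sum_f_R0 (fun i => F i n) m) c = sum_n (fun i => ev (F i) c) m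
  /\ Rbar_lt (Cmod c) (CV_radius (fun n => sum_f_R0 (fun i => F i n) m)).
Proof.
move=> cF; elim: m => [|m [IHm cm]] /=; first by rewrite sum_O; split; last exact: cF.
rewrite sum_Sn -IHm; split; last exact: CV_radius_plus_lt.
by rewrite ev_plus.
Qed.

Lemma Cmod_sum_n (G : nat -> C) m :
  Cmod (sum_n G m) <= sum_f_R0 (fun i => Cmod (G i)) m.
Proof.
elim: m => [|m IHm]; first by rewrite sum_O; apply: Rle_refl.
rewrite sum_Sn /=; apply: Rle_trans (Cmod_triangle _ _) _; lra.
Qed.

(** * Taylor coefficients of solutions of the Riccati equation *)

(** The equation [(V^2)' = 2 sigma - 2 V], read on the Taylor coefficients of
    [V] at a point. *)
Definition riccati (sigma : R) (taylor : nat -> C) : Prop := forall k,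
  (INR k.+1 * sum_n (fun i => taylor i * taylor (k.+1 - i)%N)%C k.+1)%C
  = (RtoC (if k is 0 then 2 * sigma else 0) - 2 * taylor k)%C.

(** Isolating the two extreme terms [g_0 g_{k+1}] of the convolution gives the
    hypotheses of [riccati_majorant]; the first one, [g_0 g_1 = sigma - g_0],
    gives [|g_1| <= sigma/d + 1]. *)
Lemma riccati_bound (sigma d : R) (taylor : nat -> C) :
  0 < sigma -> 0 < d -> d <= Cmod (taylor 0%N) -> riccati sigma taylor ->
  forall k, Cmod (taylor k.+1)
    <= d / 8 * ((4 + 8 * (sigma / d + 1)) / d) ^ k.+1 / INR k.+1 ^ 2.
Proof.
move=> sigma0 d0 dv taylor_rec.
have two : RtoC 2 <> RtoC 0 by move=> /RtoC_inj; lra.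
apply: (@riccati_majorant (fun k => Cmod (taylor k))) => //.
- by move=> k; apply: Cmod_ge_0.
- have := taylor_rec 0%N; rewrite sum_Sn sum_O subn0 subnn.
  move=> E; have {}E : (taylor 0%N * taylor 1%N)%C = (sigma - taylor 0%N)%C.
    have -> : (taylor 0%N * taylor 1%N = / 2 * (INR 1 * (taylor 0%N * taylor 1%N + taylor 1%N * taylor 0%N)))%C.
      by rewrite /=; field.
    by rewrite [X in (/ 2 * X)%C]E RtoC_mult; field.
  have E2 := f_equal Cmod E; rewrite Cmod_mult in E2.
  have le : Cmod (sigma - taylor 0%N)%C <= sigma + Cmod (taylor 0%N).
    by apply: Rle_trans (Cmod_triangle _ _) _; rewrite Cmod_opp Cmod_R Rabs_pos_eq; lra.
  have d1 : sigma / d * d = sigma by field; lra.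
  have sd : 0 < sigma / d by apply: Rdiv_lt_0_compat.
  apply: (Rmult_le_reg_l (Cmod (taylor 0%N))); first lra.
  rewrite E2; nra.
move=> k.
have := taylor_rec k.+1; rewrite sum_Sn subnn.
have -> : sum_n (fun i => (taylor i * taylor (k.+2 - i)%N)%C) k.+1 =
   (taylor 0%N * taylor k.+2 + sum_n (fun i => (taylor i.+1 * taylor (k - i).+1)%C) k)%C.
  rewrite /sum_n sum_Sn_m; last exact/leP.
  rewrite -sum_n_m_S; congr Cplus.
  apply: sum_n_m_ext_loc => i [_ /leP ik].
  by rewrite subSS subSn.
set S := sum_n _ k => E.
have k2 : 0 < INR k.+2 by apply: lt_0_INR; apply/ltP.
have k2C : RtoC (INR k.+2) <> RtoC 0 by move=> /RtoC_inj; lra.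
have {}E : (taylor 0%N * taylor k.+2)%C = (- (taylor k.+1 / INR k.+2 + / 2 * S))%C.
  have -> : (taylor 0%N * taylor k.+2 = / 2 * ((INR k.+2 * (taylor 0%N * taylor k.+2 + S + taylor k.+2 * taylor 0%N)) / INR k.+2 - S))%C.
    by field.
  by rewrite [X in (X / INR k.+2)%C]E; field.
have := f_equal Cmod E; rewrite Cmod_mult Cmod_opp => E2.
have S_le : Cmod S <= sum_f_R0 (fun i => Cmod (taylor i.+1) * Cmod (taylor (k - i).+1)) k.
  apply: Rle_trans (Cmod_sum_n _ _) _; apply: Req_le; apply: PartSum.sum_eq => i _.
  exact: Cmod_mult.
apply: (@Rle_trans _ (Cmod (taylor 0%N) * Cmod (taylor k.+2))).
  by apply: Rmult_le_compat_r => //; apply: Cmod_ge_0.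
rewrite E2; apply: Rle_trans (Cmod_triangle _ _) _.
rewrite Cmod_mult Cmod_div // Cmod_inv // !Cmod_R (Rabs_pos_eq 2); last lra.
rewrite Rabs_pos_eq; last lra.
apply: Rplus_le_compat_l; apply: Rmult_le_compat_l => //; lra.
Qed.

(** * The inverse branch inside its disc of convergence *)

Section InverseBranch.
Variables (sigma : R) (a : nat -> R).
Hypothesis sigma0 : 0 < sigma.
Hypothesis a0 : a 0%N = 0.

(** The coefficients of [V = 1 + sigma + sigma U - tau], the derivative of [f]
    along the branch [U]. *)
Definition slope_coef (n : nat) : R :=
  delta 0 (1 + sigma) n + sigma * a n + delta 1 (-1) n.
Local Notation v := slope_coef.

Hypothesis ode : forall n, PS_mult (PS_derive a) v n = delta 0 1 n.

Lemma derive_slope n : PS_derive v n = sigma * PS_derive a n + delta 0 (-1) n.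
Proof.
rewrite /PS_derive /v /delta; case: n => [|n] /=; first ring.
ring.
Qed.

Lemma slope_square_derive n :
  PS_derive (PS_mult v v) n = delta 0 (2 * sigma) n - 2 * v n.
Proof.
rewrite PS_derive_mult (PS_multC v).
have -> : PS_mult (PS_derive v) v n = delta 0 sigma n - v n.
  rewrite (eq_PS_mult n derive_slope (frefl _)).
  transitivity (sigma * PS_mult (PS_derive a) v n + PS_mult (delta 0 (-1)) v n).
    rewrite /PS_mult scal_sum -plus_sum; apply: PartSum.sum_eq => i _; ring.
  rewrite ode; have -> : PS_mult (delta 0 (-1)) v n = - v n.
    rewrite /PS_mult (PartSum.sum_eq _ (fun i => if i == 0%N then - v n else 0)).
      by rewrite sum_f_R0_if.
    by move=> [|i] _; rewrite /delta /= -?minusE ?Nat.sub_0_r; ring.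
  by rewrite /delta; case: ifP => _; ring.
by rewrite /delta; case: ifP => _; ring.
Qed.

Lemma slope_radius (r : R) : Rbar_lt r (CV_radius a) -> Rbar_lt r (CV_radius v).
Proof.
move=> ra; apply: CV_radius_plus_lt; last exact: delta_radius.
by apply: CV_radius_plus_lt; [apply: delta_radius|apply: CV_radius_scal_lt].
Qed.

Section Point.
Variable c : C.
Hypothesis ca : Rbar_lt (Cmod c) (CV_radius a).
Let cv : Rbar_lt (Cmod c) (CV_radius v) := slope_radius ca.

Lemma ev_slope : ev v c = (1 + sigma + sigma * ev a c - c)%C.
Proof.
rewrite /v ev_plus ?ev_plus ?ev_scal ?ev_delta //.
- by rewrite Cpow_1_r /= RtoC_plus; ring.
- exact: delta_radius.
- exact: CV_radius_scal_lt.
- by apply: CV_radius_plus_lt; [apply: delta_radius|apply: CV_radius_scal_lt].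
- exact: delta_radius.
Qed.

Lemma ev_derive_slope : (ev (PS_derive a) c * ev v c)%C = 1.
Proof.
rewrite -ev_mult ?CV_radius_derive // (ev_ext _ ode) ev_delta /=; ring.
Qed.

Definition taylor k : C := ev (hasse k v) c.

Lemma taylor0 : taylor 0 = ev v c.
Proof. by apply: ev_ext => n; rewrite /hasse addn0 bin0 Rmult_1_l. Qed.

Lemma riccati_taylor : riccati sigma taylor.
Proof.
move=> k.
have ch i : Rbar_lt (Cmod c) (CV_radius (hasse i v)) by rewrite hasse_radius.
have [E _] := @ev_sum (fun i => PS_mult (hasse i v) (hasse (k.+1 - i) v)) c k.+1
   (fun i => CV_radius_mult_lt (Cmod_ge_0 c) (ch i) (ch (k.+1 - i)%N)).
rewrite (sum_n_ext _ (fun i => ev (PS_mult (hasse i v) (hasse (k.+1 - i) v)) c)); last first.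
  by move=> i; rewrite ev_mult.
rewrite -E -ev_scal.
rewrite (@ev_ext _ (fun n => delta 0 (if k is 0 then 2 * sigma else 0) n + (Ropp 2) * hasse k v n)).
  rewrite ev_plus ?ev_delta ?ev_scal; last 2 first.
  - exact: delta_radius.
  - exact: CV_radius_scal_lt.
  by rewrite -/(taylor k) RtoC_opp /Cpow; ring.
move=> n; rewrite -hasse_mult -hasse_derive /hasse slope_square_derive.
rewrite /delta addn_eq0; case: k {E} => [|k].
  rewrite eqxx andbT bin0 INR_1; case: ifP => _; ring.
by rewrite (_ : (k.+1 == 0%N) = false) // andbF; case: ifP => _; ring.
Qed.

End Point.

(** The same equation at the centre.  It has to be read on the coefficients
    themselves because [riccati_taylor] presupposes a positive radius. *)
Lemma riccati_slope : riccati sigma (fun k => RtoC (v k)).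
Proof.
move=> k.
have -> : sum_n (fun i => (v i * v (k.+1 - i)%N)%C) k.+1 = RtoC (PS_mult v v k.+1).
  rewrite /PS_mult -sum_n_Reals; set m := (X in sum_n _ X = _).
  rewrite -[X in RtoC (sum_n _ X)]/m; elim: m => [|m IHm].
    by rewrite !sum_O -minusE RtoC_mult.
  by rewrite !sum_Sn IHm -!minusE /plus /= RtoC_plus RtoC_mult.
have := slope_square_derive k; rewrite /PS_derive -RtoC_mult => ->.
rewrite RtoC_minus RtoC_mult; congr (RtoC _ - _)%C.
by case: k.
Qed.

End InverseBranch.

(** With [z = X + i Y] and [w = p + i q] the two functions are the real and
    imaginary parts of [w e^z], and the hypotheses say that [w' + z' w = 0]. *)
Lemma derivative_exp_product (X Y p q : R -> R) (t x' y' p' q' : R) :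
  is_derive X t x' -> is_derive Y t y' -> is_derive p t p' -> is_derive q t q' ->
  p' + x' * p t - y' * q t = 0 -> q' + x' * q t + y' * p t = 0 ->
  is_derive (fun t => exp (X t) * (p t * cos (Y t) - q t * sin (Y t))) t 0 /\
  is_derive (fun t => exp (X t) * (p t * sin (Y t) + q t * cos (Y t))) t 0.
Proof.
move=> dX dY dp dq e1 e2.
have eX : ex_derive X t by exists x'.
have eY : ex_derive Y t by exists y'.
have ep : ex_derive p t by exists p'.
have eq : ex_derive q t by exists q'.
split; auto_derive => //.
  rewrite (is_derive_unique _ _ _ dX) (is_derive_unique _ _ _ dY).
  rewrite (is_derive_unique _ _ _ dp) (is_derive_unique _ _ _ dq).
  transitivity (exp (X t) * (cos (Y t) * (p' + x' * p t - y' * q t) - sin (Y t) * (q' + x' * q t + y' * p t))); first ring.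
  by rewrite e1 e2; ring.
rewrite (is_derive_unique _ _ _ dX) (is_derive_unique _ _ _ dY).
rewrite (is_derive_unique _ _ _ dp) (is_derive_unique _ _ _ dq).
transitivity (exp (X t) * (sin (Y t) * (p' + x' * p t - y' * q t) + cos (Y t) * (q' + x' * q t + y' * p t))); first ring.
by rewrite e1 e2; ring.
Qed.

Section Exponential.
Variables (sigma : R) (a : nat -> R).
Hypothesis a0 : a 0%N = 0.
Local Notation v := (slope_coef sigma a).
Hypothesis ode : forall n, PS_mult (PS_derive a) v n = delta 0 1 n.
Variable c : C.
Hypothesis ca : Rbar_lt (Cmod c) (CV_radius a).

Lemma ray_radius (t : R) : Rabs t <= 1 -> Rbar_lt (Cmod (t * c)%C) (CV_radius a).
Proof. by move=> t1; apply: Rbar_le_lt_trans ca; apply: Cmod_ray. Qed.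

Lemma ev0 f : ev f (RtoC 0 * c)%C = RtoC (f 0%N).
Proof.
rewrite ev_ray /RtoC !PSeries_0 /re_coef /im_coef /Re /Im /=; congr pair; ring.
Qed.

(** [(V - sigma) e^U] is constant along rays, as its derivative is a multiple of
    [V' + U' (V - sigma) = (sigma U' - 1) + (1 - sigma U') = 0], and it equals 1
    at the origin. *)
Lemma ev_slope_exp :
  Re (ev v c) = sigma + exp (- Re (ev a c)) * cos (Im (ev a c)) /\
  Im (ev v c) = - exp (- Re (ev a c)) * sin (Im (ev a c)).
Proof.
pose X t := Re (ev a (RtoC t * c)%C); pose Y t := Im (ev a (RtoC t * c)%C).
pose p t := Re (ev v (RtoC t * c)%C) - sigma; pose q t := Im (ev v (RtoC t * c)%C).
have deriv t : 0 <= t <= 1 ->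
  is_derive (fun t => exp (X t) * (p t * cos (Y t) - q t * sin (Y t))) t 0 /\
  is_derive (fun t => exp (X t) * (p t * sin (Y t) + q t * cos (Y t))) t 0.
  move=> t01; have t1 : Rabs t <= 1 by rewrite Rabs_pos_eq; lra.
  have ct := ray_radius t1.
  have cv := slope_radius sigma ca.
  have dv : ev (PS_derive v) (t * c)%C = (sigma * ev (PS_derive a) (t * c)%C - 1)%C.
    rewrite (@ev_ext _ _ _ (derive_slope sigma a)) ev_plus ?ev_scal ?ev_delta /Cpow.
    - by rewrite (_ : IZR (-1) = Ropp 1) ?RtoC_opp; [ring|lra].
    - by apply: CV_radius_scal_lt; rewrite CV_radius_derive.
    - exact: delta_radius.
  have av := ev_derive_slope ode ct.
  set A := (c * ev (PS_derive a) (t * c)%C)%C.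
  have AV : (A * ev v (t * c)%C)%C = c by rewrite /A -Cmult_assoc av Cmult_1_r.
  have dV : (c * ev (PS_derive v) (t * c)%C = sigma * A - c)%C by rewrite dv /A; ring.
  have dq := im_ev_derive cv t1; have dp := re_ev_derive cv t1.
  rewrite dV in dq dp.
  have e0 : (sigma * A - c + A * (ev v (t * c)%C - sigma) = 0)%C.
    transitivity (A * ev v (t * c)%C - c)%C; first ring.
    by rewrite AV; ring.
  apply: (derivative_exp_product (re_ev_derive ca t1) (im_ev_derive ca t1) (p' := Re (sigma * A - c)%C) _ dq).
  - rewrite -[Re _]Rminus_0_r; apply: (is_derive_minus (fun t : R => Re (ev v (t * c)%C))) => //.
    exact: is_derive_const.
  - have := f_equal Re e0; rewrite -/A /p /q /Re /Im /Cmult /Cminus /Cplus /Copp /RtoC /=.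
    move=> E; rewrite -[RHS]E; ring.
  - have := f_equal Im e0; rewrite -/A /p /q /Re /Im /Cmult /Cminus /Cplus /Copp /RtoC /=.
    move=> E; rewrite -[RHS]E; ring.
have h1 := eq_is_derive _ 0 1 (fun t t01 => proj1 (deriv t t01)) Rlt_0_1.
have h2 := eq_is_derive _ 0 1 (fun t t01 => proj2 (deriv t t01)) Rlt_0_1.
have vn : v 0%N = 1 + sigma by rewrite /slope_coef /delta /= a0; ring.
move: h1 h2; rewrite /X /Y /p /q !ev0 vn a0 !Cmult_1_l !re_RtoC !im_RtoC.
rewrite exp_0 cos_0 sin_0.
set x := Re (ev a c); set y := Im (ev a c).
set P := Re (ev v c); set Q := Im (ev v c) => h1 h2.
have ex : exp (- x) * exp x = 1 by rewrite -exp_plus Rplus_opp_l exp_0.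
have sc := sin2_cos2 y; rewrite /Rsqr in sc.
have eP : exp x * (P - sigma) = cos y.
  transitivity (cos y * (exp x * ((P - sigma) * cos y - Q * sin y)) + sin y * (exp x * ((P - sigma) * sin y + Q * cos y))).
    by rewrite -[exp x * (P - sigma)]Rmult_1_r -sc; ring.
  by rewrite -h1 -h2; ring.
have eQ : exp x * Q = - sin y.
  transitivity (- sin y * (exp x * ((P - sigma) * cos y - Q * sin y)) + cos y * (exp x * ((P - sigma) * sin y + Q * cos y))).
    by rewrite -[exp x * Q]Rmult_1_r -sc; ring.
  by rewrite -h1 -h2; ring.
split.
  by rewrite -eP -Rmult_assoc ex; ring.
by rewrite Ropp_mult_distr_l_reverse Ropp_mult_distr_r -eQ -Rmult_assoc ex; ring.
Qed.

End Exponential.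

(** * Behaviour near the critical points *)

Definition critical_value (sigma : R) : C := (1 + sigma - sigma * ln sigma, PI * sigma).

Lemma Cmod_le_compat (x y x' y' : R) :
  Rabs x <= Rabs x' -> Rabs y <= Rabs y' -> Cmod (x, y) <= Cmod (x', y').
Proof.
move=> xx yy; rewrite /Cmod /=; apply: sqrt_le_1_alt.
by apply: Rplus_le_compat; rewrite !Rmult_1_r; apply: Rsqr_le_abs_1.
Qed.

Lemma Cmod_le_sum (x y : R) : Cmod (x, y) <= Rabs x + Rabs y.
Proof.
have -> : (x, y) = (RtoC x + Ci * RtoC y)%C by rewrite /Ci /Cplus /Cmult /=; congr pair; ring.
apply: Rle_trans (Cmod_triangle _ _) _.
by rewrite Cmod_mult Cmod_Ci !Cmod_R Rmult_1_l; apply: Rle_refl.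
Qed.

(** The ordinate [y'] may overshoot the odd multiples of [pi]: below, only
    [|y'| >= pi] matters, which puts the point with imaginary part [sigma y'] at
    least as far from 0 as the critical value. *)
Lemma cos_near_minus1 (y k : R) : 0 < k <= 1 -> cos y <= - cos k ->
  exists y', PI <= Rabs y' /\ Rabs (y - y') <= k.
Proof.
move=> k01 cy; have [pi3 pi4] : 3 < PI /\ PI <= 4.
  by split; [have := PI2_3_2; lra|exact: PI_4].
have yk : PI - k <= Rabs y.
  case: (Rle_lt_dec (PI - k) (Rabs y)) => // lt.
  have : cos (PI - k) < cos (Rabs y).
    by have y0 := Rabs_pos y; apply: cos_decreasing_1 => //; lra.
  have -> : cos (PI - k) = - cos k by rewrite cos_minus cos_PI sin_PI; ring.
  by rewrite /Rabs; case: Rcase_abs => _; rewrite ?cos_neg; lra.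
case: (Rle_dec 0 y) => y0.
  exists (Rmax y PI); rewrite Rabs_pos_eq in yk; last lra.
  split; first by apply: Rle_trans (Rmax_r y PI) (Rle_abs _).
  by rewrite /Rmax; case: Rle_dec => ?; apply: Rabs_le; lra.
exists (Rmin y (- PI)); rewrite Rabs_left in yk; last lra.
split; first by rewrite Rabs_left; [have := Rmin_r y (- PI)|have := Rmin_r y (- PI)]; lra.
by rewrite /Rmin; case: Rle_dec => ?; apply: Rabs_le; lra.
Qed.

(** If [w = sigma + e^{-u}] is small, then [Re u] is close to [- ln sigma] and
    [|Im u|] is not much below [pi], so [tau = 1 + sigma + sigma u - w] is not
    much closer to 0 than the critical value. *)
Lemma slope_bounded_below (sigma R0 : R) : 0 < sigma ->
  R0 < Cmod (critical_value sigma) ->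
  exists d, 0 < d /\ forall (u w tau : C),
    w = (sigma + exp (- Re u) * cos (Im u), - exp (- Re u) * sin (Im u)) ->
    w = (1 + sigma + sigma * u - tau)%C ->
    Cmod tau <= R0 -> d <= Cmod w.
Proof.
move=> s0 R0lt.
pose g := Cmod (critical_value sigma) - R0.
have g0 : 0 < g by rewrite /g; lra.
have gs : 0 < g / (8 * sigma) by apply: Rdiv_lt_0_compat; lra.
pose k := Rmin 1 (g / (8 * sigma)).
have k0 : 0 < k by apply: Rmin_glb_lt; lra.
have k1 : k <= 1 := Rmin_l _ _.
have kg : sigma * k <= g / 8.
  have -> : g / 8 = sigma * (g / (8 * sigma)) by field; lra.
  by apply: Rmult_le_compat_l; [lra|exact: Rmin_r].
have pi3 : 3 < PI by have := PI2_3_2; lra.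
have ck : cos k < 1 by rewrite -cos_0; apply: cos_decreasing_1; lra.
have ek : exp (- k) < 1 by rewrite -exp_0; apply: exp_increasing; lra.
(* the three bounds control the size of w, the real part and the imaginary
   part of u respectively *)
pose d := Rmin (g / 4) (Rmin (sigma * (1 - exp (- k))) (sigma * (1 - cos k) / 2)).
have d1 : d <= g / 4 by apply: Rmin_l.
have d2 : d <= sigma * (1 - exp (- k)) by apply: Rle_trans (Rmin_r _ _) (Rmin_l _ _).
have d3 : d <= sigma * (1 - cos k) / 2 by apply: Rle_trans (Rmin_r _ _) (Rmin_r _ _).
exists d; split.
  apply: Rmin_glb_lt; first lra.
  by apply: Rmin_glb_lt; nra.
move=> [x y] w tau w1 w2 tauR; rewrite /Re /Im /= in w1.
case: (Rle_lt_dec d (Cmod w)) => // wd; exfalso.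
set e := exp (- x) in w1; have e0 : 0 < e by apply: exp_pos.
have wE : (w - sigma)%C = (e * cos y, - e * sin y).
  by rewrite w1 /Cminus /Cplus /Copp /RtoC /=; congr pair; ring.
have eE : Cmod (w - sigma)%C = e.
  rewrite wE -[RHS](@Cmod_circle e (- y)); last lra.
  by rewrite /circle cos_neg sin_neg; congr (Cmod (_, _)); ring.
have e_up : e <= sigma + Cmod w.
  rewrite -eE; apply: Rle_trans (Cmod_triangle _ _) _.
  by rewrite Cmod_opp Cmod_R Rabs_pos_eq; lra.
have e_lo : sigma - Cmod w <= e.
  have := Cmod_triangle w (- (w - sigma)%C)%C; rewrite Cmod_opp eE.
  have -> : (w + - (w - sigma) = sigma)%C by ring.
  by rewrite Cmod_R Rabs_pos_eq; lra.
have cw : sigma + e * cos y <= Cmod w.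
  have := re_le_Cmod w; rewrite {1}w1 /Re /= => le.
  by apply: Rle_trans le; apply: Rle_abs.
have cy : cos y <= - cos k.
  apply: (Rmult_le_reg_l e) => //.
  have ck0 : 0 <= cos k by apply: cos_ge_0; lra.
  nra.
have [y' [y'pi yy']] := cos_near_minus1 (conj k0 k1) cy.
have xk : Rabs (x + ln sigma) <= k.
  have lnx : x = - ln e by rewrite /e ln_exp; ring.
  have es : ln (e / sigma) = - (x + ln sigma) by rewrite ln_div // lnx; ring.
  rewrite -Rabs_Ropp -es; apply: Rabs_le; split.
    rewrite -(ln_exp (- k)); apply: ln_le; first exact: exp_pos.
    by apply/Rle_div_r => //; nra.
  rewrite -(ln_exp k); apply: ln_le; first exact: Rdiv_lt_0_compat.
  apply/Rle_div_l => //.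
  have kk : exp k * exp (- k) = 1 by rewrite -exp_plus Rplus_opp_r exp_0.
  have := exp_pos k; have := exp_pos (- k) => p1 p2.
  have : 2 - exp (- k) <= exp k by nra.
  nra.
pose zc : C := (1 + sigma - sigma * ln sigma, sigma * y').
have zc_big : Cmod (critical_value sigma) <= Cmod zc.
  apply: Cmod_le_compat; first exact: Rle_refl.
  rewrite (Rabs_mult PI) (Rabs_mult sigma) (Rmult_comm (Rabs PI)); apply: Rmult_le_compat_l; first exact: Rabs_pos.
  by rewrite (Rabs_pos_eq PI); lra.
pose dz : C := (- (sigma * (x + ln sigma)), sigma * (y' - y)).
have zcE : zc = (tau + w + dz)%C.
  rewrite {1}w2 /zc /dz /Cminus /Cplus /Copp /Cmult /RtoC /=; congr pair; ring.
have : Cmod zc <= Cmod tau + Cmod w + Cmod dz.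
  rewrite zcE; apply: Rle_trans (Cmod_triangle _ _) _.
  apply: Rplus_le_compat_r; exact: Cmod_triangle.
have := Cmod_le_sum (- (sigma * (x + ln sigma))) (sigma * (y' - y)).
rewrite Rabs_Ropp !Rabs_mult (Rabs_minus_sym y') (Rabs_pos_eq sigma); last lra.
have := Rmult_le_compat_l sigma _ _ (Rlt_le _ _ s0) xk.
have := Rmult_le_compat_l sigma _ _ (Rlt_le _ _ s0) yy'.
have gE : g = Cmod (critical_value sigma) - R0 by [].
rewrite -/dz; lra.
Qed.

(** * The radius is at least the modulus of the critical value *)

Section Binomial.
Import Order.TTheory GRing.Theory Num.Theory.
Local Open Scope R_scope.

Lemma pow_plus_binomial (x y : R) n :
  (x + y) ^ n = sum_f_R0 (fun i => INR 'C(n, i) * x ^ (n - i)%N * y ^ i) n.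
Proof.
rewrite RpowE RplusE exprDn sum_f_R0E big_mkord; apply: eq_bigr => i _.
by rewrite !RpowE INRE !RmultE -mulrA mulr_natl.
Qed.
End Binomial.

Local Open Scope R_scope.

Lemma CV_radius_ge f s M : 0 <= s ->
  (forall n, Rabs (f n.+1) * s ^ n.+1 <= M) -> Rbar_le s (CV_radius f).
Proof.
move=> s0 fM; have [ub _] := CV_radius_bounded f; apply: ub.
exists (Rmax (Rabs (f 0%N)) M) => -[|n].
  by rewrite Rmult_1_r; apply: Rmax_l.
rewrite Rabs_mult (Rabs_pos_eq (s ^ n.+1)); last exact: pow_le.
by apply: Rle_trans (fM n) _; apply: Rmax_r.
Qed.

Section InverseBranch.
Variables (sigma : R) (a : nat -> R).
Hypothesis sigma0 : 0 < sigma.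
Hypothesis a0 : a 0%N = 0.
Local Notation v := (slope_coef sigma a).
Hypothesis ode : forall n, PS_mult (PS_derive a) v n = delta 0 1 n.

Lemma radius_slope (r : R) : Rbar_lt r (CV_radius v) -> Rbar_lt r (CV_radius a).
Proof.
move=> rv.
rewrite (CV_radius_ext _ (fun n => / sigma * (v n + (delta 0 (- (1 + sigma)) n + delta 1 1 n)))).
  apply: CV_radius_scal_lt; apply: CV_radius_plus_lt => //.
  by apply: CV_radius_plus_lt; apply: delta_radius.
move=> n; rewrite /slope_coef /delta.
by case: ifP => _; case: ifP => _; field; lra.
Qed.

(** The rate in [riccati_bound]. *)
Definition growth d := (4 + 8 * (sigma / d + 1)) / d.

Lemma growth_gt0 d : 0 < d -> 0 < growth d.
Proof.
move=> d0; apply: Rdiv_lt_0_compat => //.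
by have := Rdiv_lt_0_compat _ _ sigma0 d0; lra.
Qed.

Lemma div_sqr_le (x : R) k : 0 <= x -> x / INR k.+1 ^ 2 <= x.
Proof.
move=> x0; have k1 : 1 <= INR k.+1 by rewrite S_INR; have := pos_INR k; lra.
have k2 : 1 <= INR k.+1 ^ 2 by nra.
by apply/Rle_div_l; [lra|move: (_ ^ 2) k2 => z; nra].
Qed.

Lemma radius_pos : Rbar_lt 0 (CV_radius a).
Proof.
pose d := 1 + sigma; have d0 : 0 < d by rewrite /d; lra.
have B0 := growth_gt0 d0.
have v0 : v 0%N = d by rewrite /slope_coef a0 /delta /= /d; ring.
have bound : forall k, Rabs (v k.+1) <= d / 8 * growth d ^ k.+1 / INR k.+1 ^ 2.
  move=> k; rewrite -Cmod_R.
  apply: (riccati_bound (taylor := fun k => RtoC (v k)) sigma0 d0 _ (riccati_slope ode)).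
  by rewrite Cmod_R v0 Rabs_pos_eq; lra.
apply: radius_slope; apply: (@Rbar_lt_le_trans _ (/ growth d)).
  exact: Rinv_0_lt_compat.
apply: (@CV_radius_ge _ _ (d / 8)); first by apply/Rlt_le/Rinv_0_lt_compat.
move=> n; have Bn : 0 < growth d ^ n.+1 by apply: pow_lt.
rewrite pow_inv; apply/Rle_div_l => //.
apply: Rle_trans (bound n) _; apply: div_sqr_le; nra.
Qed.

(** Cauchy's estimate for the Hasse derivatives of [V] on the circle of radius
    [r], summed against powers of [h = 1/(2 B)], bounds
    [|v_n| ((r + h)^n - r^n)]: the order 0 is left out because [V] itself is
    only bounded below.  The difference is at least [h (r + h)^{n-1}], so the
    radius is at least [r + h]; half of [h] is given up to keep the inequality
    strict. *)
Lemma radius_step d r : 0 < d -> 0 <= r -> Rbar_lt r (CV_radius a) ->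
  (forall c, Cmod c = r -> d <= Cmod (ev v c)) ->
  Rbar_lt (r + / (4 * growth d)) (CV_radius a).
Proof.
move=> d0 r0 ra vd; have B0 := growth_gt0 d0.
have cauchy N i : (i <= N)%N ->
    Rabs (v N.+1) * INR 'C(N.+1, i.+1) * r ^ (N - i)%N <= d / 8 * growth d ^ i.+1.
  move=> iN; have := @cauchy_estimate (hasse i.+1 v) r (d / 8 * growth d ^ i.+1) (N - i) r0.
  rewrite hasse_radius => /(_ (slope_radius sigma ra)).
  rewrite /hasse addnS subnK // Rabs_mult (Rabs_pos_eq (INR _)); last exact: pos_INR.
  rewrite (Rmult_comm (INR _)); apply => c cr.
  have ca : Rbar_lt (Cmod c) (CV_radius a) by rewrite cr.
  apply: Rle_trans (riccati_bound sigma0 d0 _ (riccati_taylor ode ca) i) _.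
    by rewrite taylor0; apply: vd.
  apply: div_sqr_le; apply: Rmult_le_pos; first lra.
  exact/Rlt_le/pow_lt.
pose h := / (2 * growth d).
have h0 : 0 < h by apply: Rinv_0_lt_compat; lra.
have Bh : growth d * h = / 2 by rewrite /h; field; lra.
have geom N : sum_f_R0 (fun i => (/ 2) ^ i.+1) N = 1 - (/ 2) ^ N.+1.
  elim: N => [|N IHN]; first by rewrite /=; field.
  by rewrite tech5 IHN /=; field.
apply: radius_slope; apply: (@Rbar_lt_le_trans _ (r + h)).
  have : / (4 * growth d) = h / 2 by rewrite /h; field; lra.
  by rewrite /=; lra.
apply: (@CV_radius_ge _ _ (d / 8 * ((r + h) / h))); first lra.
move=> N.
have diff : Rabs (v N.+1) * ((r + h) ^ N.+1 - r ^ N.+1) <= d / 8.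
  rewrite pow_plus_binomial decomp_sum; last exact/ltP.
  rewrite [Init.Nat.pred _]/= subn0 bin0 INR_1 Rmult_1_l [h ^ 0]/= Rmult_1_r.
  rewrite (_ : forall x y : R, x + y - x = y); last by move=> *; ring.
  rewrite scal_sum.
  apply: (@Rle_trans _ (sum_f_R0 (fun i => (/ 2) ^ i.+1 * (d / 8)) N)).
    apply: sum_Rle => i /leP iN; rewrite subSS.
    rewrite -Bh Rpow_mult_distr.
    have := Rmult_le_compat_r (h ^ i.+1) _ _ (Rlt_le _ _ (pow_lt _ i.+1 h0)) (cauchy _ _ iN).
    by rewrite /=; lra.
  rewrite -scal_sum geom; have : 0 < (/ 2) ^ N.+1 by apply: pow_lt; lra.
  nra.
have rN : r ^ N.+1 <= r * (r + h) ^ N.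
  by rewrite /=; apply: Rmult_le_compat_l => //; apply: pow_incr; lra.
have hN : h * (r + h) ^ N <= (r + h) ^ N.+1 - r ^ N.+1.
  by rewrite -[(r + h) ^ N.+1]tech_pow_Rmult; nra.
have hvN : Rabs (v N.+1) * (h * (r + h) ^ N) <= d / 8.
  apply: Rle_trans diff; apply: Rmult_le_compat_l => //; exact: Rabs_pos.
rewrite -tech_pow_Rmult.
have -> : Rabs (v N.+1) * ((r + h) * (r + h) ^ N)
  = Rabs (v N.+1) * (h * (r + h) ^ N) * ((r + h) / h) by field; lra.
apply: Rmult_le_compat_r hvN; apply/Rlt_le/Rdiv_lt_0_compat; lra.
Qed.

(** The step of [radius_step] depends only on the lower bound of [|V|] on the
    disc of radius [R0], so it can be repeated until [R0] is passed. *)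
Lemma radius_ge_critical : Rbar_le (Cmod (critical_value sigma)) (CV_radius a).
Proof.
have key R0 : 0 <= R0 -> R0 < Cmod (critical_value sigma) -> Rbar_lt R0 (CV_radius a).
  move=> R0_ge0 R0_lt.
  have [d [d0 dP]] := slope_bounded_below sigma0 R0_lt.
  have vd c : Cmod c <= R0 -> Rbar_lt (Cmod c) (CV_radius a) -> d <= Cmod (ev v c).
    move=> cR ca; apply: (dP (ev a c) _ c) => //; last exact: ev_slope.
    have [<- <-] := ev_slope_exp a0 ode ca; exact: surjective_pairing.
  pose h := / (4 * growth d).
  have h0 : 0 < h by apply: Rinv_0_lt_compat; have := growth_gt0 d0; lra.
  have steps j : INR j * h <= R0 -> Rbar_lt (INR j.+1 * h) (CV_radius a).
    elim: j => [|j IHj] jR.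
      rewrite Rmult_1_l -[h]Rplus_0_l; apply: radius_step => //; first exact: Rle_refl.
        exact: radius_pos.
      by move=> c c0; apply: vd; rewrite c0 //; exact: radius_pos.
    rewrite (S_INR j.+1) Rmult_plus_distr_r Rmult_1_l.
    have jlt : Rbar_lt (INR j.+1 * h) (CV_radius a).
      by apply: IHj; move: jR; rewrite S_INR; nra.
    apply: radius_step => //.
      by apply: Rmult_le_pos; [apply: pos_INR|apply: Rlt_le].
    by move=> c cj; apply: vd; rewrite cj.
  have [j [jle jlt]] := nfloor_ex (R0 / h) (Rdiv_le_0_compat _ _ R0_ge0 h0).
  apply: (@Rbar_lt_trans _ (INR j.+1 * h)).
    suff : R0 < INR j.+1 * h by [].
    by rewrite S_INR; apply/Rlt_div_l.
  by apply: steps; apply/Rle_div_r.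
case: (Rbar_le_lt_dec (Cmod (critical_value sigma)) (CV_radius a)) => // lt.
have := CV_radius_ge_0 a; case E : (CV_radius a) lt => [x||] //= lt x0.
by have := key x x0 lt; rewrite E /=; lra.
Qed.

(** * The radius is at most the modulus of the critical value *)

Lemma sin_gt_mul_cos u : 0 < u < PI -> u * cos u < sin u.
Proof.
move=> u0pi.
have [||x [xE x0u]] := MVT_cor2 (fun x => sin x - x * cos x) (fun x => x * sin x) 0 u.
- lra.
- move=> x _; apply/is_derive_Reals; auto_derive => //; ring.
move: xE; rewrite sin_0 => xE.
have : 0 < sin x by apply: sin_gt_0; lra.
have : 0 < x * u by nra.
by move=> p1 p2; have := Rmult_lt_0_compat _ _ p1 p2; lra.
Qed.

(** With [w = r - i u] the equations say [e^{-w} = 1 - w].  For [u > 0], the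
    imaginary part forces [e^{-r} = u / sin u > 1], hence [r < 0]; then
    [(1 - r) sin u = u cos u < sin u] is impossible. *)
Lemma exp_eq_critical (r u : R) : 0 <= u <= PI ->
  r + exp (- r) * cos u = 1 -> u = exp (- r) * sin u -> r = 0 /\ u = 0.
Proof.
move=> u0 re im; have e0 := exp_pos (- r).
case: (Req_dec u 0) => [u00|un0].
  split=> //; move: re; rewrite u00 cos_0 => re.
  case: (Req_dec r 0) => // r0.
  by have := exp_ineq1 (- r) (Ropp_neq_0_compat _ r0); lra.
have upi : u < PI.
  case: (Req_dec u PI) => [upi|]; last lra.
  by move: im; rewrite upi sin_PI; have := PI_RGT_0; lra.
have s0 : 0 < sin u by apply: sin_gt_0; lra.
have su : sin u < u by apply: sin_lt_x; lra.
have e1 : 1 < exp (- r) by nra.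
have r0 : r < 0.
  by have := ln_increasing _ _ Rlt_0_1 e1; rewrite ln_1 ln_exp; lra.
have tanu : u * cos u < sin u by apply: sin_gt_mul_cos; lra.
have : (1 - r) * sin u = u * cos u.
  have -> : 1 - r = exp (- r) * cos u by lra.
  by transitivity (exp (- r) * sin u * cos u); [ring|rewrite -im].
nra.
Qed.

(** Along the segment to the critical value [c], the imaginary part of
    [f(U) = t c] reads [t pi sigma = sigma Y + e^{-X} sin Y].  It prevents [Y]
    from taking the value [pi] or [- pi] before [t = 1]. *)
Lemma radius_le_critical : Rbar_le (CV_radius a) (Cmod (critical_value sigma)).
Proof.
case: (Rbar_le_lt_dec (CV_radius a) (Cmod (critical_value sigma))) => // lt; exfalso.
set c := critical_value sigma in lt.
have pi0 := PI_RGT_0.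
pose Y t := Im (ev a (RtoC t * c)%C); pose X t := Re (ev a (RtoC t * c)%C).
have ray t : 0 <= t <= 1 -> Rbar_lt (Cmod (RtoC t * c)%C) (CV_radius a).
  by move=> t01; apply: ray_radius => //; rewrite Rabs_pos_eq; lra.
have imE t : 0 <= t <= 1 -> t * (PI * sigma) = sigma * Y t + exp (- X t) * sin (Y t).
  move=> t01; have [_ imv] := ev_slope_exp a0 ode (ray t t01).
  have := f_equal Im (ev_slope sigma (ray t t01)); rewrite imv -/(X t) -/(Y t).
  rewrite /c /critical_value /Y /Im /Cminus /Cplus /Copp /Cmult /RtoC /=; lra.
have Ycont : forall t, 0 <= t <= 1 -> continuity_pt Y t.
  move=> t t01; apply: derivable_continuous_pt; exists (Im (c * ev (PS_derive a) (RtoC t * c)%C)%C).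
  by apply/is_derive_Reals; apply: im_ev_derive => //; rewrite Rabs_pos_eq; lra.
have Y0 : Y 0 = 0 by rewrite /Y ev0 a0.
have IVT_level y : sin y = 0 -> y <> 0 -> (0 < y < Y 1 \/ Y 1 < y < 0) ->
    exists t, 0 < t < 1 /\ t * PI = y.
  move=> sy y0 yY.
  have [t [t01 Yt]] : exists t, 0 <= t <= 1 /\ Y t = y.
    case: yY => yY.
      have [|||t [t01 ty]] := IVT_interv (fun t => Y t - y) 0 1 _ Rlt_0_1; rewrite ?Y0; try lra.
        by move=> t t01; apply: continuity_pt_minus; [apply: Ycont|apply: continuity_pt_const].
      by exists t; split => //; lra.
    have [|||t [t01 ty]] := IVT_interv (fun t => y - Y t) 0 1 _ Rlt_0_1; rewrite ?Y0; try lra.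
      by move=> t t01; apply: continuity_pt_minus; [apply: continuity_pt_const|apply: Ycont].
    by exists t; split => //; lra.
  have := imE t t01; rewrite Yt sy => E.
  have ty : t * PI = y by nra.
  exists t; split => //; split.
    by case: (Req_dec t 0) => [t0|]; [rewrite t0 in ty; lra|lra].
  by case: (Req_dec t 1) => [t1|]; [rewrite t1 in Yt; lra|lra].
have Yle : Y 1 <= PI.
  case: (Rle_lt_dec (Y 1) PI) => // lt1.
  have [|||t [t01 tpi]] := IVT_level PI; rewrite ?sin_PI; try lra.
  nra.
have Yge : 0 <= Y 1.
  case: (Rle_lt_dec 0 (Y 1)) => // lt1.
  case: (Rlt_le_dec (Y 1) (- PI)) => Ypi.
    have [|||t [t01 tpi]] := IVT_level (- PI); rewrite ?sin_neg ?sin_PI; try lra.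
    nra.
  have := imE 1; have sY : sin (Y 1) <= 0.
    by have := sin_ge_0 (- Y 1); rewrite sin_neg; lra.
  by have := exp_pos (- X 1); nra.
have t11 : 0 <= 1 <= 1 by lra.
have [rev imv] := ev_slope_exp a0 ode (ray 1 t11).
rewrite -/(X 1) -/(Y 1) in rev imv.
have reE : 1 + sigma - sigma * ln sigma = sigma * X 1 + 1 - exp (- X 1) * cos (Y 1).
  have := f_equal Re (ev_slope sigma (ray 1 t11)); rewrite rev -/(X 1).
  rewrite /c /critical_value /X /Re /Cminus /Cplus /Copp /Cmult /RtoC /=; lra.
pose r := X 1 + ln sigma; pose u := PI - Y 1.
have eX : exp (- X 1) = sigma * exp (- r).
  by rewrite /r Ropp_plus_distr exp_plus exp_Ropp (exp_Ropp (ln _)) exp_ln //; field; have := exp_pos (X 1); lra.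
have cY : cos (Y 1) = - cos u by rewrite /u cos_minus cos_PI sin_PI; ring.
have sY : sin (Y 1) = sin u by rewrite /u sin_minus cos_PI sin_PI; ring.
have [] := @exp_eq_critical r u.
- by rewrite /u; lra.
- apply: (Rmult_eq_reg_l sigma); last lra.
  by rewrite eX cY in reE; rewrite /r in reE *; lra.
- apply: (Rmult_eq_reg_l sigma); last lra.
  by have := imE 1 t11; rewrite eX sY /u; lra.
move=> r0 u0.
have v0 : ev v (RtoC 1 * c)%C = 0.
  rewrite [ev v _]surjective_pairing -/(Re _) -/(Im _) rev imv eX cY sY r0 u0.
  by rewrite Ropp_0 exp_0 cos_0 sin_0 /RtoC; congr pair; ring.
have := ev_derive_slope ode (ray 1 t11); rewrite v0 Cmult_0_r => /RtoC_inj; lra.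
Qed.

End InverseBranch.

(** * The radius of convergence *)

Lemma tau_coeff_slope_ode (sigma : R) : 0 < sigma ->
  let a := tau_coeff (1 / (1 + sigma)) in
  forall n, PS_mult (PS_derive a) (slope_coef sigma a) n = delta 0 1 n.
Proof.
move=> s0 a n.
have := tau_coeff_ode (1 / (1 + sigma)) n; rewrite -/a /PS_mult => E.
transitivity ((1 + sigma) * (if n is 0 then 1 / (1 + sigma) else 0)); last first.
  by rewrite /delta; case: n {E} => [|n] /=; field; lra.
rewrite -E scal_sum; apply: PartSum.sum_eq => i _; rewrite /slope_coef /delta.
move: (PS_derive a i) (n - i)%coq_nat => d j; clearbody a.
by case: j => [|[|j]] /=; field; lra.
Qed.

Lemma CV_radius_tau_coeff (sigma : R) : 0 < sigma ->
  CV_radius (tau_coeff (1 / (1 + sigma))) = Cmod (critical_value sigma).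
Proof.
move=> s0; have ode := tau_coeff_slope_ode s0.
by apply: Rbar_le_antisym; [apply: radius_le_critical ode|apply: radius_ge_critical ode].
Qed.

Unset Implicit Arguments.
(* [Finite] is to be the constructor of [Rbar], not the class of finite types *)
Import Rbar.

Theorem theorem11 (alpha sigma : R) (halpha : 0 < alpha) (hsigma : 0 < sigma) :
  let zeta := 1 / (1 + sigma) in
  let a := tau_coeff zeta in
  (CV_radius a
     = Finite (Cmod (1 + sigma - sigma * ln sigma + Ci * PI * sigma)%C)
   /\ CV_radius a
     = Finite (Cmod (1 + sigma - sigma * ln sigma - Ci * PI * sigma)%C))
  /\ forall x : R, 1 < x -> sigma = alpha / ln x ->
     let tau := alpha * ln (ln x) / ln x in
     let tau_star :=
       sqrt ((1 + sigma - sigma * ln sigma) ^ 2 + PI ^ 2 * sigma ^ 2) in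
     tau = sigma * (ln alpha - ln sigma)
     /\ (Rbar_lt (Finite (Rabs tau)) (CV_radius a)
         <-> Rabs (sigma * (ln alpha - ln sigma)) < tau_star)
     /\ (Rabs (sigma * (ln alpha - ln sigma)) < tau_star -> ex_pseries a tau)
     /\ (tau_star < Rabs (sigma * (ln alpha - ln sigma)) -> ~ ex_pseries a tau).
Proof.
move=> zeta a.
have aE : CV_radius a = Finite (Cmod (critical_value sigma)) by apply: CV_radius_tau_coeff.
have plus : critical_value sigma = (1 + sigma - sigma * ln sigma + Ci * PI * sigma)%C.
  by rewrite /critical_value /Ci /Cminus /Cplus /Copp /Cmult /RtoC /=; congr pair; ring.
have minus : Cconj (critical_value sigma) = (1 + sigma - sigma * ln sigma - Ci * PI * sigma)%C.
  by rewrite /critical_value /Cconj /Ci /Cminus /Cplus /Copp /Cmult /RtoC /=; congr pair; ring.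
split; first by rewrite -plus -minus Cmod_conj.
move=> x x1 sE tau tau_star.
have lnx0 : 0 < ln x by rewrite -ln_1; apply: ln_increasing; lra.
have lnxE : ln x = alpha / sigma by rewrite sE; field; lra.
have tauE : tau = sigma * (ln alpha - ln sigma).
  by rewrite /tau -ln_div // -lnxE {1}sE; field; lra.
have starE : tau_star = Cmod (critical_value sigma).
  by rewrite /tau_star /critical_value /Cmod; congr sqrt; rewrite /=; ring.
rewrite -tauE starE; split=> //; split; first by rewrite aE.
split=> lt; first by apply: CV_radius_inside; rewrite aE.
move=> [l cv]; apply: (CV_disk_outside a tau); first by rewrite aE.
apply: ex_series_lim_0; exists l; refine (is_series_ext _ _ _ _ cv) => n.
by rewrite pow_n_pow /scal /= /mult /= Rmult_comm.
Qed.
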